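(* Let $n\ge2$ and let $m,a_1,\dots,a_n$ be nonnegative integers. Let $\{c_1^{(b_1)},\dots,c_r^{(b_r)}\}$ be the multiset representation of $a_1,\dots,a_n$, i.e. $c_1<\dots<c_r$ are the distinct values among $a_1,\dots,a_n$ and $b_1,\dots,b_r\ge1$ are their multiplicities, so $b_1+\dots+b_r=n$. Let $b_+=\max\{b_1,\dots,b_r\}$. According to the explicit evaluation of the generalized Beukers integral $I_m(a_1,\dots,a_n)$ recalled in the context, it follows that $$I_m(a_1,\dots,a_n)=\frac{p_1+p_2\zeta(m+2)+\dots+p_{b_+}\zeta(m+b_+)}{q},$$ where $p_1,\dots,p_{b_+},q\in\mathbb Z$ with $\gcd(p_i,q)=1$ for all $i$ (here $p_j/q$ is the coefficient $R_j$ of that evaluation). The following estimates of $q$ hold: (i) if $r=1$, then $$q\mid \mathrm{lcm}(1,\dots,a_n)^{n+m};$$ (ii) if $r>1$, then $$q\ \Big|\ (b_+-1)!\cdot \mathrm{lcm}(1,\dots,c_r)^{m+b_+}\prod_{1\le s<t\le r}(c_t-c_s)^{n-1}.$$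
   Context: The generalized Beukers integral is $$I_m(a_1,\dots,a_n):=\frac{(-1)^m}{m!}\int_{(0,1)^n}\frac{\log^m\left(\prod_{i=1}^n x_i\right)\prod_{i=1}^n x_i^{a_i}}{1-\prod_{i=1}^n x_i}\,dx_1\cdots dx_n .$$ $H_s(x)=\sum_{k=1}^{\lfloor x\rfloor}k^{-s}$ (equal to $0$ for $x=0$), and $\zeta$ is the Riemann zeta function. The rational numbers $\mu_{ij}$ ($1\le i\le r$, $1\le j\le b_i$) are the coefficients in the partial fraction decomposition $$\prod_{i=1}^r\frac{1}{(c_i+x)^{b_i}}=\sum_{i=1}^r\sum_{j=1}^{b_i}\frac{\mu_{ij}}{(c_i+x)^j}.$$ The explicit evaluation of the integral is $$I_m(a_1,\dots,a_n)=R_1+\sum_{j=2}^{b_+}R_j\,\zeta(m+j)$$ with the following rational coefficients. If $r=1$ (so $b_+=n$): $R_1=-\binom{m+n-1}{m}H_{n+m}(c_1)$, $R_n=\binom{m+n-1}{m}$, and $R_j=0$ for $1<j<n$. If $r>1$: $$R_1=\sum_{i=1}^{r-1}\mu_{i1}\bigl(H_{m+1}(c_r)-H_{m+1}(c_i)\bigr)-\sum_{i=1}^r\sum_{j=2}^{b_i}\binom{m+j-1}{m}\mu_{ij}H_{j+m}(c_i),$$ $$R_j=\sum_{1\le i\le r,\ b_i\ge j}\binom{m+j-1}{m}\mu_{ij}\qquad(2\le j\le b_+).$$ $\mathrm{lcm}(1,\dots,N)$ is the least common multiple of $1,\dots,N$, with value $1$ for $N=0$.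
   Formalization: The condition gcd(p_i,q)=1 for every i is replaced by gcd(p_1,...,p_{b_+},q)=1, since the former can fail: for m=0, a=(0,0,2) one has R_1=-3/8, R_2=1/2, so no single q is coprime to both numerators. *)

(* Defs.v *)
From HB Require Import structures.
From mathcomp Require Import all_boot all_order all_algebra.
From mathcomp Require Import all_classical all_reals all_analysis.

Set Implicit Arguments.
Unset Strict Implicit.
Unset Printing Implicit Defensive.

Import Order.TTheory GRing.Theory Num.Theory.
Import numFieldNormedType.Exports.

Local Open Scope classical_set_scope.
Local Open Scope ring_scope.

Section tuple_cons.
Context d (T : measurableType d) (n : nat).

Definition tcons (x : (T * n.-tuple T)%type) : n.+1.-tuple T :=
  [tuple of x.1 :: x.2].

Definition tuncons (t : n.+1.-tuple T) : (T * n.-tuple T)%type :=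
  (thead t, [tuple of behead t]).

Lemma tconsK : cancel tcons tuncons.
Proof.
by move=> [x t]; rewrite /tuncons/= theadE; congr (_, _); apply/val_inj.
Qed.

Lemma measurable_tcons : measurable_fun [set: (T * n.-tuple T)%type] tcons.
Proof. exact: measurable_cons. Qed.

Lemma measurable_tuncons : measurable_fun [set: n.+1.-tuple T] tuncons.
Proof.
apply/measurable_fun_pairP; split.
  exact: (measurable_tnth (T := T) ord0).
exact: measurable_behead.
Qed.

End tuple_cons.

Section product_cons.
Local Open Scope ereal_scope.
Context d (T : measurableType d) (R : realType) (n : nat).
Variables (mu : {sigma_finite_measure set T -> \bar R})
          (nu : {sigma_finite_measure set (n.-tuple T) -> \bar R}).

(* The product measure of mu and nu, transported along
   T * T^n = T^(n+1). *)
Definition product_cons : set (n.+1.-tuple T) -> \bar R :=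
  pushforward (mu \x nu) (@tcons _ T n).

Let mcons := @measurable_tcons _ T n.

Let product_cons0 : product_cons set0 = 0.
Proof. by rewrite /product_cons/pushforward preimage_set0 measure0. Qed.

Let product_cons_ge0 A : 0 <= product_cons A.
Proof. exact: measure_ge0. Qed.

Let product_cons_sigma_additive : semi_sigma_additive product_cons.
Proof.
move=> F mF tF mUF; rewrite /product_cons /pushforward preimage_bigcup.
apply: measure_semi_sigma_additive.
- by move=> k; rewrite -[X in measurable X]setTI; exact: mcons.
- apply/trivIsetP => /= i j _ _ ij; rewrite -preimage_setI.
  by move/trivIsetP : tF => /(_ _ _ _ _ ij) ->//; rewrite preimage_set0.
- by rewrite -preimage_bigcup -[X in measurable X]setTI; exact: mcons.
Qed.

HB.instance Definition _ := isMeasure.Build _ _ _ product_cons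
  product_cons0 product_cons_ge0 product_cons_sigma_additive.

Let product_cons_sigma_finite : sigma_finite setT product_cons.
Proof.
have /sigma_finiteP[F [TF ndF Foo]] := sigma_finiteT mu.
have /sigma_finiteP[G [TG ndG Goo]] := sigma_finiteT nu.
exists (fun k => @tuncons _ T n @^-1` (F k `*` G k)).
  rewrite -preimage_bigcup; apply/esym/seteqP; split => // t _ /=.
  have [i _ Fi] : (\bigcup_k F k) (tuncons t).1 by rewrite -TF.
  have [j _ Gj] : (\bigcup_k G k) (tuncons t).2 by rewrite -TG.
  exists (maxn i j) => //; split.
    by move: Fi; apply/subsetPset/ndF/leq_maxl.
  by move: Gj; apply/subsetPset/ndG/leq_maxr.
move=> k; have [mF Fk] := Foo k; have [mG Gk] := Goo k; split.
  by rewrite -[X in measurable X]setTI; apply: measurable_tuncons => //;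
    exact: measurableX.
rewrite /product_cons /pushforward -comp_preimage.
rewrite (_ : _ \o _ = id); last by apply/funext => x; exact: tconsK.
by rewrite preimage_id product_measure1E// lte_mul_pinfty// ge0_fin_numE.
Qed.

HB.instance Definition _ := Measure_isSigmaFinite.Build _ _ _ product_cons
  product_cons_sigma_finite.

Lemma product_consE (A : set T) (B : set (n.-tuple T)) :
    measurable A -> measurable B ->
  product_cons [set t | A (thead t) /\ B [tuple of behead t]] = mu A * nu B.
Proof.
move=> mA mB; rewrite -product_measure1E// /product_cons /pushforward.
congr product_measure1; apply/seteqP; split=> -[x t] /=;
  by rewrite theadE (_ : [tuple of behead (x :: t)] = t)//; apply/val_inj.
Qed.

End product_cons.

Section lebesgue_tuple.
Context (R : realType).
Local Notation T := (measurableTypeR R).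

(* n-dimensional Lebesgue measure: the n-fold product of lebesgue_measure. *)
Fixpoint lebesgue_tuple (n : nat) :
    {sigma_finite_measure set (n.-tuple T) -> \bar R} :=
  match n return {sigma_finite_measure set (n.-tuple T) -> \bar R} with
  | 0 => [the {sigma_finite_measure set (0.-tuple T) -> \bar R} of
            @dirac _ (0.-tuple T) [tuple] R]
  | n'.+1 => [the {sigma_finite_measure set (n'.+1.-tuple T) -> \bar R} of
            product_cons lebesgue_measure (lebesgue_tuple n')]
  end.

Lemma lebesgue_tuple_box (n : nat) (A : 'I_n -> set T) :
    (forall i, measurable (A i)) ->
  lebesgue_tuple n [set t | forall i, A i (tnth t i)] =
  (\prod_(i < n) lebesgue_measure (A i))%E.
Proof.
elim: n A => [|n IH] A mA.
  rewrite big_ord0 /= (_ : [set _ | _] = setT) ?diracT//.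
  by apply/seteqP; split => // t _ [].
rewrite big_ord_recl -IH; last by move=> i; exact: mA.
rewrite -product_consE//=; last first.
  rewrite (_ : [set _ | _] =
      \bigcap_(i in [set: 'I_n]) ((@tnth n T ^~ i) @^-1` A (lift ord0 i))).
    apply: fin_bigcap_measurable => // i _; rewrite -[X in measurable X]setTI.
    exact: measurable_tnth.
  by apply/seteqP; split => [t At i _|t At i]; [exact: At|exact: (At i)].
congr product_cons; apply/seteqP; split=> [t At|t [A0 At] i].
  split=> [|i]; first exact: At.
  by rewrite (_ : tnth _ i = tnth t (lift ord0 i))// [in RHS](tuple_eta t) tnthS.
have [j ->|->] := unliftP ord0 i; last exact: A0.
by rewrite (tuple_eta t) tnthS; exact: At.
Qed.

End lebesgue_tuple.

(* Evaluated only at integers s >= 2, where the Dirichlet series converges. *)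
Definition zeta (R : realType) (s : R) : R := limn (series (riemannR s)).

Definition open_cube (R : realType) (n : nat) :
    set (n.-tuple (measurableTypeR R)) :=
  [set x | forall i : 'I_n, 0 < (tnth x i : R) < 1].

Definition beukers_integral (R : realType) (m n : nat) (a : n.-tuple nat) :
    \bar R :=
  (((-1) ^+ m / m`!%:R)%:E *
   \int[@lebesgue_tuple R n]_(x in @open_cube R n)
     (ln (\prod_(i < n) (tnth x i : R)) ^+ m *
      \prod_(i < n) (tnth x i : R) ^+ tnth a i /
      (1 - \prod_(i < n) (tnth x i : R)))%:E)%E.

(* Multiset representation of a finite sequence of natural numbers a:
   mcard a = r is the number of distinct values, mval a 1 < ... < mval a r are
   these values and mmul a i is the multiplicity of mval a i.  Indices start
   at 1; outside 1 <= i <= r the values are irrelevant. *)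
Definition mcard (a : seq nat) : nat := size (undup a).
Definition mval (a : seq nat) (i : nat) : nat :=
  nth 0%N (sort leq (undup a)) i.-1.
Definition mmul (a : seq nat) (i : nat) : nat := count_mem (mval a i) a.
Definition mmul_max (a : seq nat) : nat :=
  (\max_(1 <= i < (mcard a).+1) mmul a i)%N.

(* mu i j, for 1 <= i <= r and 1 <= j <= b_i, are the coefficients of the
   partial fraction decomposition; equality of rational functions over rat is
   equality at every x where no denominator vanishes. *)
Definition partial_fractions (a : seq nat) (mu : nat -> nat -> rat) : Prop :=
  forall x : rat,
    (forall i, (1 <= i <= mcard a)%N -> (mval a i)%:R + x != 0) ->
    \prod_(1 <= i < (mcard a).+1) (((mval a i)%:R + x) ^+ mmul a i)^-1 =
    \sum_(1 <= i < (mcard a).+1) \sum_(1 <= j < (mmul a i).+1)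
       mu i j / ((mval a i)%:R + x) ^+ j.

Definition Hsum (s N : nat) : rat := \sum_(1 <= k < N.+1) (k%:R ^+ s)^-1.

(* R_j of the explicit evaluation, for 1 <= j <= b_+. *)
Definition beukers_coef (m : nat) (a : seq nat) (mu : nat -> nat -> rat)
    (j : nat) : rat :=
  let n := size a in
  let r := mcard a in
  let c := mval a in
  let b := mmul a in
  if r == 1%N then
    if j == 1%N then - 'C(m + n - 1, m)%:R * Hsum (n + m) (c 1%N)
    else if j == n then 'C(m + n - 1, m)%:R
    else 0
  else
    if j == 1%N then
      \sum_(1 <= i < r) mu i 1%N * (Hsum m.+1 (c r) - Hsum m.+1 (c i))
      - \sum_(1 <= i < r.+1) \sum_(2 <= k < (b i).+1)
          'C(m + k - 1, m)%:R * mu i k * Hsum (k + m) (c i)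
    else \sum_(1 <= i < r.+1 | (j <= b i)%N) 'C(m + j - 1, m)%:R * mu i j.

(* rho 1, ..., rho b are written over the common denominator q, in lowest
   terms: the integers p 1, ..., p b, q have no common factor (a numerator may
   well share a factor with q on its own). This determines q up to sign. *)
Definition reduced_fractions (b : nat) (rho : nat -> rat) (p : nat -> int)
    (q : int) : Prop :=
  [/\ q != 0,
      forall j, (1 <= j <= b)%N -> rho j = (p j)%:~R / q%:~R &
      \big[gcdz/q]_(1 <= j < b.+1) p j = 1].

Definition lcm_upto (N : nat) : nat := (\big[lcmn/1]_(1 <= k < N.+1) k)%N.

(* Main.v *)
Require Import Defs.
From mathcomp Require Import all_boot all_order all_algebra.
From mathcomp Require Import all_classical all_reals all_analysis.
From mathcomp Require Import measurable_realfun ftc.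
From mathcomp Require Import ring lra zify.

Set Implicit Arguments.
Unset Strict Implicit.
Unset Printing Implicit Defensive.

Import Order.TTheory GRing.Theory Num.Theory.
Import numFieldNormedType.Exports.

Local Open Scope ring_scope.

(** Write L for - ln (x_1 ... x_n).  Expanding 1 / (1 - x_1 ... x_n) into a
    geometric series, the integral becomes the sum over k >= 0 of the integrals
    of (L ^ m / m!) * x_1 ^ (a_1 + k) * ... * x_n ^ (a_n + k) over the cube.
    By Tonelli and the one-dimensional formula for the integral of
    (- ln x) ^ m / m! * x ^ s, which is (s + 1) ^ -(m + 1), such an integral is
    the coefficient of t ^ m in the product of the 1 / (a_i + k + 1 - t)
    ([log_moment], [integral_log_pow_tmonom]).

    For m = 0 this coefficient is the rational function whose partial fraction
    decomposition defines the mu_ij; for general m one applies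
    (-1) ^ m / m! (d / dx) ^ m to that decomposition, so that
    1 / (c + x) ^ j becomes binom(m + j - 1, m) / (c + x) ^ (m + j).  Both facts
    are proved together, without derivatives, by induction on the list
    a_1, ..., a_n: multiplying by (x + e) undoes the insertion of e into the
    list, and this translates into a triangular recurrence between the old and
    the new coefficients ([partial_fraction_expansion]).  Each step of the
    recurrence divides by one difference of two values; counting these
    divisions shows that the coefficient of 1 / (c + x) ^ j, multiplied by the
    (n - j)-th power of the product P of all differences c_t - c_s, is an
    integer.

    Summing over k, each 1 / (c + k + 1) ^ s with s >= 2 contributes
    zeta(s) - H_s(c).  The simple poles contribute for every m only the
    H_(m+1)(c), as their coefficients add up to 0; for m = 0 this is what makes
    the sum converge ([cvg_pf_sum]).

    A decomposition is unique ([pf_sum_inj]), so any mu satisfying the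
    hypothesis inherits these properties, and the rational numbers R_j are
    those found by the summation ([beukers_coef1], [beukers_coefS]).  As
    lcm(1, ..., c) ^ t * H_s(c) is an integer for s <= t, all R_j become integers
    after multiplication by lcm(1, ..., c_r) ^ (m + b_max) * P ^ (n - 1).  Hence
    q divides this number, which gives both estimates: if r = 1 then P = 1,
    b_max = n, and c_r is every a_i. *)

(** * Partial fractions and complete homogeneous sums *)

(** The coefficient of t ^ m in the product of the 1 / (e + x - t), e in s:
    a complete homogeneous symmetric polynomial in the 1 / (e + x), times
    their product. *)
Fixpoint log_moment (F : fieldType) (x : F) (s : seq nat) (m : nat) : F :=
  if s is e :: s' then
    \sum_(l < m.+1) (e%:R + x) ^- l.+1 * log_moment x s' (m - l)
  else (m == 0%N)%:R.

Lemma log_moment_cons0 (F : fieldType) (x : F) e s : e%:R + x != 0 ->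
  (e%:R + x) * log_moment x (e :: s) 0 = log_moment x s 0.
Proof. by move=> y0; rewrite /= big_ord1 expr1 mulrA divff// mul1r. Qed.

Lemma log_moment_consS (F : fieldType) (x : F) e s m : e%:R + x != 0 ->
  (e%:R + x) * log_moment x (e :: s) m.+1 =
  log_moment x s m.+1 + log_moment x (e :: s) m.
Proof.
move=> y0; rewrite /= big_ord_recl mulrDr expr1 mulrA divff// mul1r subn0.
congr (_ + _); rewrite mulr_sumr; apply: eq_bigr => i _.
by rewrite lift0 subSS mulrA exprS invfM mulrA divff// mul1r.
Qed.

(** The operator (-1) ^ m / m! (d / dy) ^ m applied to 1 / y ^ (j + 1).  Orders
    of poles are shifted by one here and below: index j stands for
    the pole of order j + 1. *)
Definition diff_pole (F : fieldType) (m : nat) (y : F) (j : nat) : F :=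
  'C(m + j, m)%:R / y ^+ (m + j).+1.

Lemma mulf_divXS (F : fieldType) (y c : F) n : y != 0 ->
  y * (c / y ^+ n.+1) = c / y ^+ n.
Proof. by move=> y0; rewrite mulrCA exprS invfM mulVKf. Qed.

(** Pascal's rule. *)
Lemma diff_poleSS (F : fieldType) m (y : F) j : y != 0 ->
  y * diff_pole m.+1 y j.+1 = diff_pole m.+1 y j + diff_pole m y j.+1.
Proof.
by move=> y0; rewrite /diff_pole mulf_divXS// addSn addnS binS natrD mulrDl addSn.
Qed.

Lemma diff_poleS0 (F : fieldType) m (y : F) : y != 0 ->
  y * diff_pole m.+1 y 0 = diff_pole m y 0.
Proof. by move=> y0; rewrite /diff_pole mulf_divXS// !addn0 !binn. Qed.

Lemma diff_pole0S (F : fieldType) (y : F) j : y != 0 ->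
  y * diff_pole 0 y j.+1 = diff_pole 0 y j.
Proof. by move=> y0; rewrite /diff_pole mulf_divXS// !bin0 !add0n. Qed.

Lemma diff_pole00 (F : fieldType) (y : F) : y != 0 -> y * diff_pole 0 y 0 = 1.
Proof. by move=> y0; rewrite /diff_pole mulf_divXS// bin0 mul1r invr1. Qed.

Definition pf_sum (V : seq nat) (N : nat) (lam : nat -> nat -> rat) m (x : rat) :=
  \sum_(v <- V) \sum_(j < N) lam v j * diff_pole m (v%:R + x) j.

(** One step of the induction.  The coefficients [lam] belong to a function f,
    and [lam'] to f / (x + e); the relation [step] comes from
    x + e = (x + v) + (e - v), where x + v lowers the order of a pole at - v. *)
Section step.
Variables (V : seq nat) (N e : nat) (lam lam' : nat -> nat -> rat) (x : rat).
Hypothesis step : forall v j, v \in V ->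
  lam v j = lam' v j.+1 + (e%:R - v%:R) * lam' v j.
Hypothesis top : forall v, v \in V -> v != e -> lam' v N = 0.
Hypothesis x0 : forall v, v \in V -> v%:R + x != 0.

Let top_term m v : v \in V ->
  (e%:R + x) * \sum_(j < N.+1) lam' v j * diff_pole m (v%:R + x) j =
  \sum_(j < N.+1) lam' v j * ((v%:R + x) * diff_pole m (v%:R + x) j)
  + \sum_(j < N) (e%:R - v%:R) * lam' v j * diff_pole m (v%:R + x) j.
Proof.
move=> vV.
have -> : \sum_(j < N) (e%:R - v%:R) * lam' v j * diff_pole m (v%:R + x) j
  = \sum_(j < N.+1) (e%:R - v%:R) * lam' v j * diff_pole m (v%:R + x) j.
  rewrite big_ord_recr/=; have [->|ve] := eqVneq v e.
    by rewrite subrr !mul0r addr0.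
  by rewrite (top vV ve) mulr0 mul0r addr0.
rewrite mulr_sumr -big_split/=; apply: eq_bigr => j _; ring.
Qed.

Lemma pf_sum_stepS m :
  (e%:R + x) * pf_sum V N.+1 lam' m.+1 x =
  pf_sum V N lam m.+1 x + pf_sum V N.+1 lam' m x.
Proof.
rewrite /pf_sum mulr_sumr -big_split/=; apply: eq_big_seq => v vV.
rewrite top_term// big_ord_recl diff_poleS0 ?x0//.
under [X in (_ + X) + _ = _]eq_bigr => i _ do rewrite lift0 diff_poleSS ?x0// mulrDr.
rewrite big_split/= [X in _ = _ + X]big_ord_recl.
under [X in _ = X + _]eq_bigr => j _ do rewrite (step _ vV) mulrDl.
by rewrite big_split/=; ring.
Qed.

(** The condition on the simple poles says that, after multiplication by x + e,
    no constant is left over. *)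
Lemma pf_sum_step0 : \sum_(v <- V) lam' v 0%N = 0 ->
  (e%:R + x) * pf_sum V N.+1 lam' 0 x = pf_sum V N lam 0 x.
Proof.
move=> s0.
transitivity (\sum_(v <- V) lam' v 0%N + pf_sum V N lam 0 x); last first.
  by rewrite s0 add0r.
rewrite /pf_sum mulr_sumr -big_split/=.
apply: eq_big_seq => v vV.
rewrite top_term// big_ord_recl diff_pole00 ?x0// mulr1 -addrA; congr (_ + _).
rewrite -big_split/=; apply: eq_bigr => j _.
by rewrite /bump leq0n add1n diff_pole0S ?x0// (step _ vV); ring.
Qed.

End step.

(** The solution of the recurrence of the previous section: at v != e it is
    solved downwards from the vanishing coefficient of index N, at e the poles
    move up by one order, and the remaining simple pole at - e is chosen so that
    the residues add up to 0. *)
Definition pf_next (V : seq nat) (N e : nat) (lam : nat -> nat -> rat) v j : rat :=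
  let rest v j :=
    \sum_(j <= i < N) (-1) ^+ (i - j) * lam v i / (e%:R - v%:R) ^+ (i - j).+1 in
  if v != e then rest v j
  else if j is j'.+1 then lam e j'
  else - \sum_(w <- V | w != e) rest w 0%N.

Lemma pf_next_step V N e lam v j :
  (forall j, (N <= j)%N -> lam v j = 0) ->
  lam v j = pf_next V N e lam v j.+1 + (e%:R - v%:R) * pf_next V N e lam v j.
Proof.
move=> lam0; rewrite /pf_next; have [->|ve] := eqVneq v e.
  by rewrite subrr mul0r addr0.
have ev0 : e%:R - v%:R != 0 :> rat by rewrite subr_eq0 eqr_nat eq_sym.
have [jN|Nj] := ltnP j N; last first.
  by rewrite !big_geq ?lam0 ?mulr0 ?addr0// ltnW.
rewrite [in X in _ * X]big_ltn// subnn mul1r expr1 mulrDr addrCA mulrCA divff// mulr1.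
rewrite mulr_sumr -big_split/= big_nat big1 ?addr0// => i /andP[ji iN].
by rewrite -(subnSK ji) mulf_divXS// [(-1) ^+ _.+1]exprS mulN1r !mulNr subrr.
Qed.

Lemma pf_next_sum0 V N e lam : e \in V -> uniq V ->
  \sum_(v <- V) pf_next V N e lam v 0 = 0.
Proof.
move=> eV uV; rewrite (bigD1_seq e)//= {1}/pf_next eqxx/= addrC.
apply/eqP; rewrite subr_eq0; apply/eqP/eq_bigr => v ve.
by rewrite /pf_next ve.
Qed.

(** Existence for all m at once, with the control of denominators.  Any V
    containing the values and any common multiple P of the differences
    can be fixed in advance, which lets the same P serve in all steps of the
    induction on s: the coefficient of index i contributes to index j with the
    denominator (e - v) ^ (i - j + 1), whereas the exponent of P available
    grows from N - i - 1 to N - j, by exactly that power, where N is the size of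
    the list before the step. *)
Lemma partial_fraction_expansion (V : seq nat) (P : rat) (s : seq nat) :
  uniq V -> P \is a Num.int ->
  {in V &, forall v w, v != w -> P / (v%:R - w%:R) \is a Num.int} ->
  {subset s <= V} -> s != [::] ->
  exists lam : nat -> nat -> rat,
  [/\ forall v j, (count_mem v s <= j)%N -> lam v j = 0,
      forall v j, v \in V -> (j < size s)%N ->
        lam v j * P ^+ (size s - j.+1) \is a Num.int,
      (1 < size s)%N -> \sum_(v <- V) lam v 0%N = 0 &
      forall m x, {in V, forall v, v%:R + x != 0} ->
        log_moment x s m = pf_sum V (size s) lam m x].
Proof.
move=> uV Pint Pdiv; elim: s => // e [_|f s IH] sV _.
  have eV : e \in V by apply: sV; rewrite mem_head.
  exists (fun v j => ((v == e) && (j == 0%N))%:R); split => //.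
  - move=> v j /=; rewrite addn0 eq_sym.
    by case: (v == e) => //=; case: j.
  - by move=> v j vV j1; apply: rpredM; [exact: rpred_nat|exact: rpredX].
  move=> m x x0; rewrite /pf_sum (bigD1_seq e)//= !big_ord1 eqxx.
  rewrite [X in _ = _ + X]big1; last first.
    by move=> v /negbTE ->; rewrite big_ord1 mul0r.
  rewrite big_ord_recr/= subnn mulr1 big1 ?add0r.
    by rewrite mul1r addr0 /diff_pole addn0 binn mul1r.
  by move=> i _; rewrite subn_eq0 leqNgt ltn_ord mulr0.
have eV : e \in V by apply: sV; rewrite mem_head.
have [|//|lam [lam0 lamP _ lamE]] := IH.
  by move=> v vs; apply: sV; rewrite inE vs orbT.
set t := f :: s in lam0 lamP lamE *; pose N := size t.
have lamN v j : (N <= j)%N -> lam v j = 0.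
  by move=> Nj; apply: lam0; rewrite (leq_trans _ Nj)// count_size.
pose lam' := pf_next V N e lam.
have rest_int v j : v \in V -> v != e -> (j < N)%N ->
    lam' v j * P ^+ (N - j) \is a Num.int.
  move=> vV ve jN; rewrite /lam' /pf_next ve mulr_suml big_nat rpred_sum// => i.
  move=> /andP[ji iN].
  have -> : (N - j = (N - i.+1) + (i - j).+1)%N by lia.
  rewrite exprD mulrACA [X in _ * X]mulrC -expr_div_n; apply: rpredM.
    by rewrite -mulrA; apply: rpredM; [rewrite rpredX// rpredN rpred1|exact: lamP].
  by rewrite rpredX// Pdiv// eq_sym.
exists lam'; split.
- move=> v [|j] /=.
    rewrite leqn0 addn_eq0 => /andP[ev /eqP cv].
    have ve : v != e by move: ev; rewrite (eq_sym e); case: (v == e).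
    rewrite /lam' /pf_next ve big1// => i _.
    by rewrite lam0 ?mulr0 ?mul0r// (cv : count_mem v t = 0%N).
  rewrite /lam' /pf_next (eq_sym e); have [<-|ve] /= := eqVneq v e.
    by rewrite add1n ltnS; exact: lam0.
  rewrite add0n => cj; rewrite big_nat big1// => i /andP[ji _].
  by rewrite lam0 ?mulr0 ?mul0r// (leq_trans cj)// ltnW.
- move=> v [|j] vV; rewrite /= -/t -/N => jN; rewrite subSS ?subn0.
    have [->|ve] := eqVneq v e; last by have := rest_int v 0%N vV ve isT; rewrite subn0.
    rewrite /lam' /pf_next eqxx/= mulNr rpredN mulr_suml big_seq_cond.
    rewrite rpred_sum// => w /andP[wV we].
    by have := rest_int w 0%N wV we isT; rewrite /lam' /pf_next we subn0.
  have [->|ve] := eqVneq v e.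
    by rewrite /lam' /pf_next eqxx/=; exact: lamP.
  have [jN'|jN'] := ltnP j.+1 N; first exact: rest_int.
  rewrite /lam' /pf_next ve big_geq ?mul0r//.
- by move=> _; exact: pf_next_sum0.
have step v j : v \in V -> lam v j = lam' v j.+1 + (e%:R - v%:R) * lam' v j.
  by move=> _; apply: pf_next_step => k; exact: lamN.
have top v : v \in V -> v != e -> lam' v N = 0.
  by move=> _ ve; rewrite /lam' /pf_next ve big_geq.
move=> m x x0; have ex0 := x0 e eV.
apply: (mulfI ex0); elim: m => [|m IHm].
  rewrite log_moment_cons0// lamE// (pf_sum_step0 step)//.
  exact: pf_next_sum0.
rewrite log_moment_consS// lamE// (mulfI ex0 IHm).
by rewrite [in RHS]/= (pf_sum_stepS step).
Qed.

(** * Uniqueness of partial fractions *)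

Lemma poly_vanishing_on_nat (p : {poly rat}) :
  (forall k : nat, p.[k.+1%:R] = 0) -> p = 0.
Proof.
move=> p0; apply: (@roots_geq_poly_eq0 _ p [seq k.+1%:R | k <- iota 0 (size p)]).
- by apply/allP => _ /mapP[k _ ->]; rewrite rootE p0.
- rewrite map_inj_uniq ?iota_uniq// => i j /eqP.
  by rewrite eqr_nat eqSS => /eqP.
- by rewrite size_map size_iota.
Qed.

(** Clearing denominators gives a polynomial identity in which all terms
    belonging to w != v are divisible by (X + v) ^ N.  By coprimality
    the numerator at v is divisible by it too, and its degree is less than N. *)
Lemma pf_sum_eq0 (V : seq nat) (N : nat) (nu : nat -> nat -> rat) :
  uniq V -> (forall k, pf_sum V N nu 0 k.+1%:R = 0) ->
  forall v j, v \in V -> (j < N)%N -> nu v j = 0.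
Proof.
move=> uV nu0 v j vV jN.
pose X_ (w : nat) : {poly rat} := 'X + (w%:R)%:P.
pose A w := (\poly_(i < N) nu w (N.-1 - i)%N) \Po X_ w.
pose Q w := \prod_(u <- V | u != w) X_ u ^+ N.
have X_gt0 w (k : nat) : w%:R + k.+1%:R != 0 :> rat.
  by rewrite -natrD pnatr_eq0 addnS.
have AE w (k : nat) : (A w).[k.+1%:R] =
    (w%:R + k.+1%:R) ^+ N * \sum_(j < N) nu w j * diff_pole 0 (w%:R + k.+1%:R) j.
  rewrite /A horner_comp !hornerE horner_poly mulr_sumr (reindex_inj rev_ord_inj)/=.
  apply: eq_bigr => i _; rewrite /diff_pole bin0 add0n.
  have -> : (N.-1 - (N - i.+1) = i)%N by have := ltn_ord i; lia.
  rewrite [k.+1%:R + _]addrC mul1r mulrCA; congr (_ * _).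
  have /(congr1 (GRing.exp (w%:R + k.+1%:R : rat))) := subnK (ltn_ord i).
  by rewrite exprD => <-; rewrite mulfK// expf_neq0.
have sum0 : \sum_(w <- V) A w * Q w = 0.
  apply: poly_vanishing_on_nat => k; rewrite horner_sum.
  transitivity ((\prod_(u <- V) (u%:R + k.+1%:R) ^+ N) * pf_sum V N nu 0 k.+1%:R); last first.
    by rewrite nu0 mulr0.
  rewrite /pf_sum mulr_sumr; apply: eq_big_seq => w wV.
  rewrite hornerM AE horner_prod mulrAC [in RHS](bigD1_seq w)//=.
  congr (_ * _ * _); apply: eq_bigr => u _.
  by rewrite horner_exp !hornerE addrC.
have X_dvd w : w != v -> X_ v ^+ N %| Q w.
  move=> wv; rewrite /Q -big_filter (bigD1_seq v) ?filter_uniq//= ?dvdp_mulr//.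
  by rewrite mem_filter eq_sym wv.
have : X_ v ^+ N %| A v * Q v.
  move: sum0; rewrite (bigD1_seq v)//= => /eqP; rewrite addr_eq0 => /eqP ->.
  rewrite dvdpNr; apply: (big_ind (fun p => X_ v ^+ N %| p)) => [|p q|w wv].
  - exact: dvdp0.
  - exact: dvdp_add.
  - by rewrite dvdp_mull// X_dvd.
have X_E w : X_ w = 'X - (- w%:R)%:P by rewrite /X_ polyCN opprK.
rewrite Gauss_dvdpl; last first.
  apply: (big_ind (fun q => coprimep (X_ v ^+ N) q)).
  - exact: coprimep1.
  - by move=> p q cp cq; rewrite coprimepMr cp.
  move=> u uv; apply/coprimep_expl/coprimep_expr; rewrite [X_ u]X_E.
  by rewrite coprimep_XsubC rootE !hornerE addrC subr_eq0 eqr_nat eq_sym.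
have sX : size (X_ v) = 2%N by rewrite X_E size_XsubC.
move=> dA; have A0 : A v = 0.
  apply/eqP; apply: contraT => A0; have := dvdp_leq A0 dA.
  rewrite X_E size_exp_XsubC /A size_comp_poly2// leqNgt ltnS.
  by rewrite size_poly.
move/eqP: A0; rewrite /A comp_poly2_eq0// => /eqP/polyP/(_ (N.-1 - j)%N).
by rewrite coef_poly coef0 ifT ?subKn//; lia.
Qed.

(** * Distinct values and multiplicities *)

Definition values (a : seq nat) := sort leq (undup a).

Lemma values_uniq a : uniq (values a).
Proof. by rewrite sort_uniq undup_uniq. Qed.

Lemma mem_values a v : (v \in values a) = (v \in a).
Proof. by rewrite mem_sort mem_undup. Qed.

Lemma size_values a : size (values a) = mcard a.
Proof. by rewrite size_sort. Qed.

Lemma big_mval (T : Type) (idx : T) (op : T -> T -> T) (a : seq nat) (F : nat -> T) :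
  \big[op/idx]_(1 <= i < (mcard a).+1) F (mval a i) =
  \big[op/idx]_(v <- values a) F v.
Proof. by rewrite big_add1 [RHS](big_nth 0%N) size_values. Qed.

Lemma mval_values a i : (1 <= i <= mcard a)%N -> mval a i \in values a.
Proof. by case: i => // i /= ir; rewrite mem_nth// size_values. Qed.

Lemma index_mval a i : (1 <= i <= mcard a)%N -> (index (mval a i) (values a)).+1 = i.
Proof. by case: i => // i /= ir; rewrite index_uniq ?values_uniq// size_values. Qed.

Lemma mval_index a v : v \in a -> mval a (index v (values a)).+1 = v.
Proof. by rewrite -mem_values => va; rewrite /mval/= nth_index. Qed.

Lemma index_values a v : v \in a -> (1 <= (index v (values a)).+1 <= mcard a)%N.
Proof. by rewrite -mem_values -size_values index_mem. Qed.

Lemma ltn_mval a i j : (1 <= i)%N -> (i < j <= mcard a)%N -> (mval a i < mval a j)%N.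
Proof.
case: i j => // i [|j]// _ /andP[ij jr].
have ss : sorted ltn (values a).
  by rewrite ltn_sorted_uniq_leq values_uniq sort_sorted//; exact: leq_total.
apply: (sorted_ltn_nth ltn_trans 0%N ss) => //; rewrite inE size_values//.
by apply: leq_trans jr; rewrite ltnW.
Qed.

Lemma log_moment0 (x : rat) a :
  log_moment x a 0 = \prod_(1 <= i < (mcard a).+1) (((mval a i)%:R + x) ^+ mmul a i)^-1.
Proof.
rewrite (big_mval _ _ a (fun v => ((v%:R + x) ^+ count_mem v a)^-1)).
rewrite (perm_big _ (permEl (perm_sort leq (undup a))))/=.
transitivity (\prod_(v <- a) (v%:R + x)^-1).
  elim: a => [|e a IH] /=; first by rewrite big_nil.
  by rewrite big_ord1 subn0 expr1 IH big_cons.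
rewrite -[LHS]big_undup_iterop_count; apply: eq_bigr => v _.
by rewrite -exprVn.
Qed.

(** Coefficients indexed by the position of a value and the order of the pole,
    reindexed by the value itself and extended by 0 beyond the multiplicity. *)
Definition coefs_by_value (a : seq nat) (mu : nat -> nat -> rat) v j : rat :=
  if (j < count_mem v a)%N then mu (index v (values a)).+1 j.+1 else 0.

Lemma pf_sum_mval (a : seq nat) (mu : nat -> nat -> rat) x :
  \sum_(1 <= i < (mcard a).+1) \sum_(1 <= j < (mmul a i).+1)
       mu i j / ((mval a i)%:R + x) ^+ j =
  pf_sum (values a) (size a) (coefs_by_value a mu) 0 x.
Proof.
rewrite /pf_sum -big_mval; apply: eq_big_nat => i ir.
rewrite big_add1/= big_mkord (big_ord_widen _
  (fun j => mu i j.+1 / ((mval a i)%:R + x) ^+ j.+1)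
  (count_size (pred1 (mval a i)) a)).
rewrite big_mkcond/=; apply: eq_bigr => j _.
rewrite /coefs_by_value index_mval// /mmul /diff_pole bin0 add0n.
by case: ifP => _; rewrite ?mul0r// mul1r.
Qed.

Lemma pf_sum_inj (V : seq nat) N lam nu : uniq V ->
  (forall k, pf_sum V N lam 0 k.+1%:R = pf_sum V N nu 0 k.+1%:R) ->
  forall v j, v \in V -> (j < N)%N -> lam v j = nu v j.
Proof.
move=> uV E v j vV jN; apply/eqP; rewrite -subr_eq0; apply/eqP.
apply: (@pf_sum_eq0 V N (fun v j => lam v j - nu v j)) => // k.
rewrite -[RHS](subrr (pf_sum V N nu 0 k.+1%:R)) -{1}E /pf_sum -sumrB.
apply: eq_bigr => w _; rewrite -sumrB; apply: eq_bigr => i _.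
by rewrite mulrBl.
Qed.

Definition value_gaps (a : seq nat) : nat :=
  \prod_(1 <= s < (mcard a).+1) \prod_(s.+1 <= t < (mcard a).+1) (mval a t - mval a s).

Lemma value_gaps_exp (a : seq nat) k :
  (\prod_(1 <= s < (mcard a).+1) \prod_(s.+1 <= t < (mcard a).+1)
    (mval a t - mval a s) ^ k)%N = (value_gaps a ^ k)%N.
Proof.
have M : {morph (fun x => x ^ k)%N : x y / (x * y)%N} by move=> x y; rewrite expnMn.
rewrite /value_gaps (big_morph _ M (exp1n k)); apply: eq_bigr => i _.
by rewrite (big_morph _ M (exp1n k)).
Qed.

Lemma value_gaps_gt0 a : (0 < value_gaps a)%N.
Proof.
rewrite /value_gaps big_nat prodn_cond_gt0// => s /andP[s1 sr].
rewrite big_nat prodn_cond_gt0// => t /andP[st tr].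
by rewrite subn_gt0 ltn_mval// st.
Qed.

Lemma dvdn_value_gaps a s t : (1 <= s)%N -> (s < t <= mcard a)%N ->
  (mval a t - mval a s %| value_gaps a)%N.
Proof.
move=> s1 /andP[st tr]; rewrite /value_gaps (bigD1_seq s) ?iota_uniq//=; last first.
  by rewrite mem_index_iota s1/= ltnS (leq_trans (ltnW st)).
rewrite dvdn_mulr// (bigD1_seq t) ?iota_uniq//= ?dvdn_mulr//.
by rewrite mem_index_iota st.
Qed.

Lemma value_gaps_div a : {in values a &, forall v w, v != w ->
  (value_gaps a)%:R / (v%:R - w%:R) \is a @Num.int rat}.
Proof.
have main s t : (1 <= s)%N -> (s < t <= mcard a)%N ->
    (value_gaps a)%:R / ((mval a t)%:R - (mval a s)%:R) \is a @Num.int rat.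
  move=> s1 st; have lt := ltn_mval s1 st.
  have /dvdnP[q ->] := dvdn_value_gaps s1 st.
  rewrite -natrB 1?ltnW// natrM mulfK ?rpred_nat//.
  by rewrite pnatr_eq0 subn_eq0 -ltnNge.
move=> v w; rewrite !mem_values => va wa vw.
rewrite -(mval_index va) -(mval_index wa).
have := index_values va; have := index_values wa.
set s := (index w _).+1; set t := (index v _).+1 => /andP[s1 sr] /andP[t1 tr].
have [st|ts|st] := ltngtP s t.
- by apply: main => //; rewrite st.
- by rewrite -opprB invrN mulrN rpredN main// ts.
- by move: vw; rewrite -(mval_index va) -(mval_index wa) -/s -/t st eqxx.
Qed.

(** * The coefficients of the evaluation *)

(** With [zeta_coef] below, the coefficients of the evaluation as they come out
    of the summation over k, whatever the number of distinct values. *)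
Definition harmonic_coef m (V : seq nat) n (lam : nat -> nat -> rat) : rat :=
  - \sum_(v <- V) \sum_(j < n) lam v j * 'C(m + j, m)%:R * Hsum (m + j).+1 v.

Definition zeta_coef m (V : seq nat) (lam : nat -> nat -> rat) j : rat :=
  \sum_(v <- V) lam v j * 'C(m + j, m)%:R.

Lemma mcard_gt0 a : (0 < size a)%N -> (0 < mcard a)%N.
Proof.
rewrite -size_values; case: a => // e s _.
have : e \in values (e :: s) by rewrite mem_values mem_head.
by case: (values _).
Qed.

Lemma mmul_single a : mcard a = 1%N -> mmul a 1 = size a.
Proof.
move=> r1; apply/eqP; rewrite /mmul -all_count; apply/allP => v va /=.
have := index_values va; rewrite r1 => /andP[_].
rewrite ltnS leqn0 => /eqP iv.
by rewrite -(mval_index va) iv.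
Qed.

Lemma sum_values_single a (F : nat -> rat) : mcard a = 1%N ->
  \sum_(v <- values a) F v = F (mval a 1).
Proof. by move=> r1; rewrite -big_mval r1 big_nat1. Qed.

Lemma sum_delta_last (F : nat -> rat) n : (0 < n)%N ->
  \sum_(j < n) (j == n.-1 :> nat)%:R * F j = F n.-1.
Proof.
case: n => // n _; rewrite big_ord_recr/= eqxx mul1r big1 ?add0r// => i _.
by rewrite ltn_eqF// mul0r.
Qed.

Section coefs.
Variables (a : seq nat) (lam mu : nat -> nat -> rat) (m : nat).
Hypothesis lam0 : forall v j, (count_mem v a <= j)%N -> lam v j = 0.
Hypothesis sum_lam0 : \sum_(v <- values a) lam v 0%N = 0.
Hypothesis lamE : forall m x, {in values a, forall v, v%:R + x != 0} ->
  log_moment x a m = pf_sum (values a) (size a) lam m x.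

(** Both sides are decompositions of the same function, so this is uniqueness. *)
Lemma coefs_by_value_uniq v j : partial_fractions a mu -> v \in a ->
  (j < count_mem v a)%N -> mu (index v (values a)).+1 j.+1 = lam v j.
Proof.
move=> pf va jv.
have <- : coefs_by_value a mu v j = lam v j.
  apply: (@pf_sum_inj (values a) (size a)); rewrite ?values_uniq ?mem_values//.
    move=> k; rewrite -lamE//.
    rewrite log_moment0 -pf_sum_mval pf//.
  exact: leq_trans jv (count_size _ _).
by rewrite /coefs_by_value jv.
Qed.

Lemma pf_coefE i j : partial_fractions a mu -> (1 <= i <= mcard a)%N ->
  (1 <= j <= mmul a i)%N -> mu i j = lam (mval a i) j.-1.
Proof.
move=> pf ir; case: j => // j /= jb.
by rewrite -(coefs_by_value_uniq pf) ?index_mval// -mem_values mval_values.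
Qed.

(** With a single value c the function is 1 / (c + x) ^ n already. *)
Lemma expansion_single j : mcard a = 1%N -> (j < size a)%N ->
  lam (mval a 1) j = (j == (size a).-1)%:R.
Proof.
move=> r1 jn.
have c_in : mval a 1 \in values a by apply: mval_values; rewrite r1.
apply: (@pf_sum_inj (values a) (size a) lam (fun _ j => (j == (size a).-1)%:R)) => //.
  exact: values_uniq.
move=> k; rewrite -lamE//.
rewrite log_moment0 r1 big_nat1 mmul_single// /pf_sum.
rewrite -(big_mval _ _ a (fun v => \sum_(j < size a) (j == (size a).-1 :> nat)%:R *
  diff_pole 0 (v%:R + k.+1%:R) j)) r1 big_nat1.
have n0 : (0 < size a)%N by exact: leq_ltn_trans jn.
have nn : ((size a).-1 < size a)%N by rewrite prednK.
rewrite (bigD1 (Ordinal nn))//= eqxx big1 ?addr0; last first.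
  move=> i; rewrite -val_eqE/= => /negbTE ->; by rewrite mul0r.
by rewrite mul1r /diff_pole bin0 add0n prednK// mul1r.
Qed.

(** For r > 1 the coefficient mu_r1 is eliminated by means of the vanishing
    sum of the residues. *)
Lemma beukers_coef1 : (2 <= size a)%N -> partial_fractions a mu ->
  beukers_coef m a mu 1 = harmonic_coef m (values a) (size a) lam.
Proof.
move=> n2 pf; rewrite /beukers_coef /=; case: eqP => [r1|r1].
  rewrite /harmonic_coef sum_values_single// mulNr; congr (- _).
  under eq_bigr => j _ do rewrite expansion_single// -mulrA.
  rewrite (sum_delta_last (fun j => 'C(m + j, m)%:R * Hsum (m + j).+1 (mval a 1)));
    last exact: ltnW.
  have -> : (m + (size a).-1 = m + size a - 1)%N by lia.
  by congr (_ * Hsum _ _); lia.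
have split1 v : v \in values a ->
    \sum_(j < size a) lam v j * 'C(m + j, m)%:R * Hsum (m + j).+1 v =
    lam v 0%N * Hsum m.+1 v +
    \sum_(2 <= k < (count_mem v a).+1) 'C(m + k - 1, m)%:R * lam v k.-1 * Hsum (k + m) v.
  rewrite mem_values => va.
  pose G j := lam v j * 'C(m + j, m)%:R * Hsum (m + j).+1 v.
  transitivity (\sum_(0 <= j < count_mem v a) G j).
    rewrite (big_nat_widen _ _ _ _ _ (count_size _ _)) big_mkord [RHS]big_mkcond/=.
    by apply: eq_bigr => j _; case: ltnP => // vj; rewrite lam0// !mul0r.
  have cv : (0 < count_mem v a)%N by rewrite -has_count has_pred1.
  rewrite big_ltn// {1}/G addn0 binn mulr1; congr (_ + _).
  rewrite [RHS]big_add1/=; apply: eq_bigr => j _.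
  by rewrite /G addnS subn1/= [_ * lam _ _]mulrC addSn addnC.
rewrite /harmonic_coef [in RHS]big_seq (eq_bigr _ split1) -big_seq big_split/= opprD.
congr (_ + _); last first.
  rewrite -big_mval; congr (- _); apply: eq_big_nat => i ir.
  apply: eq_big_nat => k /andP[k2 kb].
  by rewrite pf_coefE// (ltnW k2).
have r0 : (0 < mcard a)%N by exact/mcard_gt0/ltnW.
have muE i : (1 <= i <= mcard a)%N -> mu i 1%N = lam (mval a i) 0%N.
  move=> ir; rewrite pf_coefE//= /mmul -has_count has_pred1 -mem_values.
  exact: mval_values.
have Es : \sum_(1 <= i < mcard a) mu i 1%N = - lam (mval a (mcard a)) 0%N.
  apply/eqP; rewrite -addr_eq0 -[X in _ == X]sum_lam0 -big_mval big_nat_recr//=.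
  apply/eqP; congr (_ + _); apply: eq_big_nat => i /andP[i1 ir].
  by rewrite muE// i1 ltnW.
under eq_bigr do rewrite mulrBr.
rewrite sumrB -mulr_suml Es -big_mval [in RHS]big_nat_recr//= opprD mulNr addrC.
congr (- _ + _); apply: eq_big_nat => i /andP[i1 ir].
by rewrite muE// i1 ltnW.
Qed.

Lemma beukers_coefS j : (2 <= size a)%N -> partial_fractions a mu ->
  (0 < j < size a)%N ->
  beukers_coef m a mu j.+1 = zeta_coef m (values a) lam j.
Proof.
move=> n2 pf /andP[j0 jn]; rewrite /beukers_coef /= eqSS (gtn_eqF j0).
have E1 : (j.+1 == size a) = (j == (size a).-1).
  by rewrite -[in LHS](prednK (ltnW n2)).
case: eqP => [r1|r1].
  rewrite /zeta_coef sum_values_single// expansion_single// E1.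
  by case: eqP => [->|_]; rewrite ?mul0r// mul1r -subn1 addnBA// ltnW.
rewrite /zeta_coef -big_mval big_mkcond/=; apply: eq_big_nat => i ir.
case: ifPn => [jb|]; first by rewrite pf_coefE//= mulrC addnS subn1.
by rewrite -leqNgt => bj; rewrite lam0// mul0r.
Qed.

End coefs.

(** * Common denominators *)

Lemma dvdn_lcm_upto k N : (1 <= k <= N)%N -> (k %| lcm_upto N)%N.
Proof.
move=> /andP[k1 kN]; rewrite /lcm_upto (bigD1_seq k) ?iota_uniq//= ?dvdn_lcml//.
by rewrite mem_index_iota k1.
Qed.

Lemma lcm_upto_gt0 N : (0 < lcm_upto N)%N.
Proof.
rewrite /lcm_upto big_nat; apply: (big_ind (fun x => 0 < x)%N) => // [x y x0 y0|k /andP[]//].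
by rewrite lcmn_gt0 x0.
Qed.

(** For k <= v, k ^ s divides lcm(1, ..., N) ^ s. *)
Lemma Hsum_int s t v N : (v <= N)%N -> (s <= t)%N ->
  (lcm_upto N ^ t)%N%:R * Hsum s v \is a @Num.int rat.
Proof.
move=> vN st; rewrite /Hsum mulr_sumr big_nat rpred_sum// => k /andP[k1 kv].
have /dvdnP[q ->] : (k %| lcm_upto N)%N.
  by rewrite dvdn_lcm_upto// k1 (leq_trans _ vN).
have k0 : k%:R != 0 :> rat by rewrite pnatr_eq0 -lt0n.
rewrite -(subnKC st) expnD mulnC natrM -mulrA rpredM ?rpred_nat//.
rewrite expnMn natrM (natrX _ k s) mulfK ?rpred_nat//.
by rewrite expf_neq0.
Qed.

Lemma count_le_max a v : v \in a -> (count_mem v a <= mmul_max a)%N.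
Proof.
move=> va; rewrite /mmul_max.
have -> : count_mem v a = mmul a (index v (values a)).+1 by rewrite /mmul mval_index.
by apply: (@leq_bigmax_seq _ _ xpredT); rewrite // mem_index_iota index_values.
Qed.

Lemma mmul_max_le a : (mmul_max a <= size a)%N.
Proof. by apply/bigmax_leqP_seq => i _ _; exact: count_size. Qed.

Lemma le_mval_max a v : v \in a -> (v <= mval a (mcard a))%N.
Proof.
move=> va; rewrite -(mval_index va); have /andP[i1] := index_values va.
by rewrite leq_eqVlt => /predU1P[->//|ir]; rewrite ltnW// ltn_mval// ir/=.
Qed.

Definition denominator_bound m a : nat :=
  (lcm_upto (mval a (mcard a)) ^ (m + mmul_max a) * value_gaps a ^ (size a - 1))%N.

Lemma denominator_bound_gt0 m a : (0 < denominator_bound m a)%N.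
Proof. by rewrite muln_gt0 !expn_gt0 lcm_upto_gt0 value_gaps_gt0. Qed.

Section integrality.
Variables (a : seq nat) (lam : nat -> nat -> rat) (m : nat).
Hypothesis lam0 : forall v j, (count_mem v a <= j)%N -> lam v j = 0.
Hypothesis lam_int : forall v j, v \in values a -> (j < size a)%N ->
  lam v j * (value_gaps a)%:R ^+ (size a - j.+1) \is a Num.int.

Lemma expansion_gaps_int v j : v \in values a -> (j < size a)%N ->
  (value_gaps a ^ (size a - 1))%N%:R * lam v j \is a Num.int.
Proof.
move=> va jn; have -> : (size a - 1 = size a - j.+1 + j)%N by lia.
rewrite expnD natrM mulrAC natrX [_ ^+ _ * _]mulrC rpredM ?rpred_nat//.
exact: lam_int.
Qed.

Lemma harmonic_coef_int :
  (denominator_bound m a)%:R * harmonic_coef m (values a) (size a) lam \is a Num.int.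
Proof.
rewrite /harmonic_coef mulrN rpredN mulr_sumr big_seq rpred_sum// => v va.
rewrite mulr_sumr rpred_sum// => j _.
have [cj|jc] := leqP (count_mem v a) j; first by rewrite lam0// !mul0r mulr0 rpred0.
have va' : v \in a by rewrite -mem_values.
have b_ge : (j < mmul_max a)%N by exact: leq_trans jc (count_le_max va').
rewrite /denominator_bound natrM.
set L := (lcm_upto _ ^ _)%N; set G := (value_gaps a ^ _)%N.
have -> : L%:R * G%:R * (lam v j * 'C(m + j, m)%:R * Hsum (m + j).+1 v) =
    G%:R * lam v j * ('C(m + j, m)%:R * (L%:R * Hsum (m + j).+1 v)) by ring.
rewrite rpredM ?expansion_gaps_int// rpredM ?rpred_nat// Hsum_int//.
  exact: le_mval_max.
by rewrite -addnS leq_add2l.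
Qed.

Lemma zeta_coef_int j : (j < size a)%N ->
  (denominator_bound m a)%:R * zeta_coef m (values a) lam j \is a Num.int.
Proof.
move=> jn; rewrite /zeta_coef mulr_sumr big_seq rpred_sum// => v va.
rewrite mulrA rpredM ?rpred_nat// /denominator_bound natrM -mulrA.
by rewrite rpredM ?rpred_nat// expansion_gaps_int.
Qed.
End integrality.

Lemma big_gcdz_mull (g q : int) (p : nat -> int) (s : seq nat) : 0 <= g ->
  \big[gcdz/g * q]_(j <- s) (g * p j) = g * \big[gcdz/q]_(j <- s) p j.
Proof.
move=> g0; elim: s => [|j s IH]; first by rewrite !big_nil.
by rewrite !big_cons IH -mulz_gcdr gez0_abs.
Qed.

Lemma dvdz_mul_big_gcdz (q : int) (D : nat) (p : nat -> int) (s : seq nat) :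
  {in s, forall j, (q %| D%:Z * p j)%Z} -> (q %| D%:Z * \big[gcdz/q]_(j <- s) p j)%Z.
Proof.
elim: s => [|j s IH] H; first by rewrite big_nil dvdz_mull.
rewrite big_cons (mulz_gcdr D%:Z) dvdz_gcd H ?mem_head//= IH// => k ks.
by rewrite H// inE ks orbT.
Qed.

(** Divide a common denominator D and the numerators D * rho j by their gcd. *)
Lemma reduced_fractions_exists b (rho : nat -> rat) (D : nat) : (0 < D)%N ->
  (forall j, (1 <= j <= b)%N -> D%:R * rho j \is a Num.int) ->
  exists p q, reduced_fractions b rho p q.
Proof.
move=> D0 Dint; pose z j := numq (D%:R * rho j).
pose g := \big[gcdz/D%:Z]_(1 <= j < b.+1) z j.
have g_dvd (s : seq nat) : (\big[gcdz/D%:Z]_(j <- s) z j %| D%:Z)%Z /\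
    {in s, forall j, (\big[gcdz/D%:Z]_(j <- s) z j %| z j)%Z}.
  elim: s => [|i s [IHD IHz]]; first by rewrite big_nil.
  rewrite big_cons; split; first by rewrite (dvdz_trans (dvdz_gcdr _ _)).
  move=> j; rewrite inE => /predU1P[->|js]; first exact: dvdz_gcdl.
  by rewrite (dvdz_trans (dvdz_gcdr _ _))// IHz.
have [/dvdzP[q qD] gz] := g_dvd (index_iota 1 b.+1); rewrite -/g in qD gz.
have D0' : D%:Z != 0 by move: D0; rewrite lt0n.
have g0 : g != 0 by apply: contra_neq D0' => g0; rewrite qD g0 mulr0.
have q0 : q != 0 by apply: contra_neq D0' => q0; rewrite qD q0 mul0r.
have g_ge0 : 0 <= g.
  by rewrite /g; case: index_iota => [|j s]; rewrite ?big_nil ?big_cons.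
have pz j : (1 <= j <= b)%N -> z j = g * (z j %/ g)%Z.
  move=> jb; rewrite mulrC divzK// gz// mem_index_iota.
  by [].
exists (fun j => (z j %/ g)%Z), q; split => //.
- move=> j jb; have DR : D%:R != 0 :> rat by rewrite pnatr_eq0 -lt0n.
  apply: (mulfI DR); rewrite -{1}(numqK (Dint j jb)) -/(z j) {1}(pz j jb).
  have -> : D%:R = (q * g)%:~R :> rat by rewrite -qD.
  rewrite !rmorphM/=; field.
  by rewrite intr_eq0.
apply: (mulfI g0); rewrite -big_gcdz_mull// mulr1 mulrC -qD.
by rewrite /g; apply: eq_big_nat => j jb; rewrite -pz.
Qed.

(** From D * p j = (D * rho j) * q one gets that q divides D times each of the
    jointly coprime integers p j and q, hence D. *)
Lemma reduced_fractions_dvd b rho p q (D : nat) : reduced_fractions b rho p q ->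
  (forall j, (1 <= j <= b)%N -> D%:R * rho j \is a Num.int) ->
  (q %| D%:Z)%Z.
Proof.
move=> [q0 rhoE gcd1] Dint; rewrite -[D%:Z]mulr1 -gcd1.
apply: dvdz_mul_big_gcdz => j; rewrite mem_index_iota => jb.
apply/dvdzP; exists (numq (D%:R * rho j)); apply/eqP.
rewrite -(eqr_int rat) !rmorphM/= numqK ?Dint// rhoE//.
by rewrite mulrA divfK// intr_eq0.
Qed.

(** * The one-dimensional integral *)

Section one_dim.
Local Open Scope classical_set_scope.
Context (R : realType).
Implicit Types (x : R) (s m : nat).

Definition log_pow m x : R := (- ln x) ^+ m / m`!%:R.

Lemma log_pow_ge0 m x : x <= 1 -> 0 <= log_pow m x.
Proof. by move=> x1; rewrite divr_ge0// exprn_ge0// oppr_ge0 ln_le0. Qed.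

Lemma measurable_log_pow m : measurable_fun setT (log_pow m).
Proof.
apply: measurable_funM => //; apply: measurable_funX.
by apply: measurableT_comp => //; exact: measurable_ln.
Qed.

(** A primitive of [log_pow m x * x ^+ s], obtained by iterated integration by
    parts. *)
Fixpoint log_monomial_prim s m x : R :=
  (log_pow m x * x ^+ s.+1 + (if m is m'.+1 then log_monomial_prim s m' x else 0)) / s.+1%:R.

Lemma is_derive_log_powS m x : 0 < x ->
  is_derive x 1 (log_pow m.+1) (- (x^-1 * log_pow m x)).
Proof.
move=> x0; have := is_derive1_ln x0 => dln.
have -> : log_pow m.+1 = (m.+1`!%:R^-1) *: ((- (@ln R)) ^+ m.+1).
  by apply/funext => y; rewrite /log_pow !fctE; apply: mulrC.
apply: is_derive_eq; rewrite /log_pow factS natrM.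
rewrite !fctE /GRing.scale/=.
field.
by rewrite nat1r !pnatr_eq0 -lt0n fact_gt0 gt_eqF.
Qed.

Lemma is_derive_log_monomial_prim s m x : 0 < x ->
  is_derive x 1 (log_monomial_prim s m) (log_pow m x * x ^+ s).
Proof.
move=> x0; elim: m => [|m IH].
  have -> : log_monomial_prim s 0 = (s.+1%:R^-1) *: (id ^+ s.+1 : R -> R).
    by apply/funext => y; rewrite /= /log_pow expr0 fact0 invr1 !mul1r addr0 !fctE; apply: mulrC.
  apply: is_derive_eq; rewrite /GRing.scale/= /log_pow expr0 fact0 invr1 !mul1r mulr1.
  by rewrite mulKf// pnatr_eq0.
have dl := is_derive_log_powS m x0.
have -> : log_monomial_prim s m.+1 = (s.+1%:R^-1) *: 
    ((log_pow m.+1 * (id ^+ s.+1)) + log_monomial_prim s m).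
  by apply/funext => y; rewrite !fctE; apply: mulrC.
apply: is_derive_eq; rewrite /GRing.scale/= !fctE/=.
rewrite exprS; by field; rewrite nat1r pnatr_eq0 gt_eqF.
Qed.

Lemma log_monomial_prim1 s m : log_monomial_prim s m 1 = s.+1%:R ^- m.+1.
Proof.
elim: m => [|m IH] /=.
  by rewrite /log_pow expr0 fact0 expr1n invr1 !mul1r addr0 mul1r.
by rewrite IH /log_pow ln1 oppr0 expr0n/= mul0r mul0r add0r [in RHS]exprSr invfM.
Qed.

(** The integrand may be unbounded at 0, so the integral is a limit along
    x = exp (- (k + 1)); there exp y >= y ^ (l + 1) / (l + 1)! makes the powers of
    the logarithm negligible. *)
Lemma cvg_log_monomial_prim0 s m : log_monomial_prim s m (expR (- k.+1%:R)) @[k --> \oo] --> (0 : R).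
Proof.
have H l : log_pow l (expR (- k.+1%:R)) * expR (- k.+1%:R) ^+ s.+1 @[k --> \oo] --> (0 : R).
  apply: (@squeeze_cvgr _ _ _ _ (cst 0) (fun k : nat => l.+1%:R * k.+1%:R^-1 : R)).
  - near=> k; have e1 : expR (- k.+1%:R) <= 1 :> R by rewrite expR_le1 oppr_le0.
    apply/andP; split; first by rewrite mulr_ge0 ?log_pow_ge0 ?exprn_ge0 ?expR_ge0.
    rewrite (@le_trans _ _ (log_pow l (expR (- k.+1%:R)) * expR (- k.+1%:R)))//.
      rewrite ler_wpM2l ?log_pow_ge0// exprS.
      by apply: ler_piMr; [exact: expR_ge0|apply: exprn_ile1 => //; exact: expR_ge0].
    rewrite /log_pow expRK opprK expRN.
    have := @expR_ge1Dxn R k.+1%:R l (ler0n _ _).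
    move=> /(le_trans (ler_wpDl ler01 (lexx _))) h.
    rewrite ler_pdivrMr ?expR_gt0//; apply: le_trans (ler_wpM2l _ h); last first.
      by rewrite mulr_ge0.
    rewrite le_eqVlt; apply/orP; left; apply/eqP.
    rewrite factS natrM exprS; field.
    by rewrite !nat1r !pnatr_eq0 -lt0n fact_gt0.
  - exact: cvg_cst.
  - rewrite -(mulr0 (l.+1%:R : R)); apply: cvgMl_tmp.
    exact: cvg_harmonic.
elim: m => [|m IH]; rewrite /= -[X in _ --> X](mul0r (s.+1%:R^-1)); apply: cvgMr_tmp.
  under eq_fun do rewrite addr0.
  exact: H.
rewrite -[X in _ --> X]addr0; apply: cvgD; [exact: H|exact: IH].
Unshelve. all: by end_near. Qed.

Notation mu := (@lebesgue_measure R).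

Lemma integral_log_pow_pow s m :
  (\int[mu]_(x in `]0%R, 1%R[) (log_pow m x * x ^+ s)%:E = (s.+1%:R ^- m.+1)%:E)%E.
Proof.
pose f x := log_pow m x * x ^+ s.
have mf : measurable_fun setT f.
  by apply: measurable_funM; [exact: measurable_log_pow|exact: measurable_funX].
have mEf D : measurable_fun D (EFin \o f).
  by apply/measurable_funTS/measurable_EFinP.
pose D k : set R := `[expR (- k.+1%:R), 1]%classic.
have e0 k : 0 < expR (- k.+1%:R) :> R by exact: expR_gt0.
have DE : \bigcup_k D k = `]0%R, 1%R]%classic.
  apply/seteqP; split=> x /=.
    move=> [k _]; rewrite /D/= !in_itv/= => /andP[kx ->]; rewrite andbT.
    exact: lt_le_trans kx.
  rewrite in_itv/= => /andP[x0 x1].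
  exists (Num.truncn (- ln x)) => //=; rewrite /D/= in_itv/= x1 andbT.
  by rewrite -[leRHS]lnK ?posrE// ler_expR lerNl ltW// truncnS_gt.
transitivity (\int[mu]_(x in `]0%R, 1%R[) (EFin \o f) x)%E; first by [].
rewrite (integral_itv_bndo_bndc (mEf _)) -DE.
have intD k : (\int[mu]_(x in D k) (f x)%:E =
    (log_monomial_prim s m 1 - log_monomial_prim s m (expR (- k.+1%:R)))%:E)%E.
  have dF x : 0 < x -> derivable (log_monomial_prim s m) x 1.
    by move=> x0; have [] := is_derive_log_monomial_prim s m x0.
  have cF x : 0 < x -> {for x, continuous (log_monomial_prim s m)}.
    by move=> x0; apply/differentiable_continuous/derivable1_diffP/dF.
  have cf x : 0 < x -> {for x, continuous f}.
    move=> x0; apply: cvgM; last exact: exprn_continuous.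
    apply: cvgM; last exact: cvg_cst.
    apply: (@continuous_comp _ _ _ (fun x => - ln x) (fun x => x ^+ m)).
      by apply: cvgN; exact: continuous_ln.
    exact: exprn_continuous.
  rewrite (@continuous_FTC2 _ _ (log_monomial_prim s m)) ?EFinB//.
  - apply: continuous_in_subspaceT => x; rewrite inE/= in_itv/= => /andP[ex _].
    by apply: cf; exact: lt_le_trans ex.
  - split.
    + move=> x; rewrite in_itv/= => /andP[ex _]; apply: dF; exact: lt_trans ex.
    + by apply: cvg_at_right_filter; exact: cF.
    + by apply: cvg_at_left_filter; exact: cF.
  - move=> x; rewrite in_itv/= => /andP[ex _]; rewrite derive1E.
    by have dx := is_derive_log_monomial_prim s m (lt_trans (e0 k) ex); rewrite derive_val.
have := @ge0_nondecreasing_set_cvg_integral _ (measurableTypeR R) R D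
  (EFin \o f) lebesgue_measure.
move=> /(_ _ _ _ _)/cvg_lim => <-//.
- apply/cvg_lim => //; under eq_fun do rewrite intD.
  rewrite -log_monomial_prim1; apply: cvg_EFin; first exact: nearW.
  rewrite -[X in _ --> X]subr0; apply: cvgB; first exact: cvg_cst.
  exact: cvg_log_monomial_prim0.
- apply/nondecreasing_seqP => k; rewrite subsetEset /D; apply: subset_itvr.
  by rewrite bnd_simp ler_expR lerN2 ler_nat.
- by move=> k; exact: measurable_itv.
- by move=> k; exact: mEf.
- move=> k x; rewrite /D/= in_itv/= => /andP[ex x1]; rewrite lee_fin.
  rewrite mulr_ge0 ?log_pow_ge0// exprn_ge0//.
  by apply/ltW/(lt_le_trans _ ex).
Qed.
End one_dim.

(** * Integration over the cube *)

Section cube.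
Local Open Scope classical_set_scope.
Context (R : realType).
Local Notation T := (measurableTypeR R).

Definition tprod n (t : n.-tuple T) : R := \prod_(i < n) (tnth t i : R).
Definition tmonom n (a : n.-tuple nat) (t : n.-tuple T) : R :=
  \prod_(i < n) (tnth t i : R) ^+ tnth a i.

Lemma log_powM m (x y : R) : 0 < x -> 0 < y ->
  log_pow m (x * y) = \sum_(l < m.+1) log_pow l x * log_pow (m - l) y.
Proof.
move=> x0 y0; rewrite /log_pow lnM ?posrE// opprD addrC exprDn mulr_suml.
apply: eq_bigr => l _; have lm : (l <= m)%N by rewrite -ltnS.
rewrite -(bin_fact lm) !natrM -mulr_natr.
have f0 k : k`!%:R != 0 :> R by rewrite pnatr_eq0 -lt0n fact_gt0.
by field; rewrite !f0 pnatr_eq0 -lt0n bin_gt0 lm.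
Qed.

Lemma measurable_coord n (i : 'I_n) : measurable_fun setT (fun t : n.-tuple T => tnth t i : R).
Proof. exact: measurable_tnth. Qed.

Lemma measurable_tprod n : measurable_fun setT (@tprod n).
Proof. by apply: measurable_prod => i _; exact: measurable_coord. Qed.

Lemma measurable_tmonom n a : measurable_fun setT (@tmonom n a).
Proof.
by apply: measurable_prod => i _; apply: measurable_funX; exact: measurable_coord.
Qed.

Lemma measurable_open_cube n : measurable (@open_cube R n).
Proof.
rewrite (_ : @open_cube R n =
    \bigcap_(i in [set: 'I_n]) ((@tnth n T ^~ i) @^-1` `]0, 1[%classic)).
  apply: fin_bigcap_measurable => // i _; rewrite -[X in measurable X]setTI.
  by apply: measurable_tnth => //; exact: measurable_itv.
by apply/seteqP; split => [t t01 i _|t t01 i]; have := t01 i; rewrite /= in_itv//=; exact.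
Qed.

Lemma tprod_gt0 n (t : n.-tuple T) : open_cube t -> 0 < tprod t.
Proof. by move=> t01; apply: prodr_gt0 => i _; have /andP[] := t01 i. Qed.

Lemma tprod_le1 n (t : n.-tuple T) : open_cube t -> tprod t <= 1.
Proof.
move=> t01; apply: prodr_ile1 => i _; have /andP[/ltW t0 /ltW t1] := t01 i.
by rewrite t0.
Qed.

Lemma tmonom_ge0 n a (t : n.-tuple T) : open_cube t -> 0 <= tmonom a t.
Proof.
by move=> t01; apply: prodr_ge0 => i _; apply: exprn_ge0; have /andP[/ltW] := t01 i.
Qed.

Lemma tprod_cons n (x : T) (t : n.-tuple T) : tprod (tcons (x, t)) = x * tprod t.
Proof.
rewrite /tprod big_ord_recl /tcons/= tnth0; congr (_ * _).
by apply: eq_bigr => i _; rewrite tnthS.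
Qed.

Lemma tmonom_cons n a (x : T) (t : n.-tuple T) :
  tmonom a (tcons (x, t)) = (x : R) ^+ thead a * tmonom [tuple of behead a] t.
Proof.
rewrite /tmonom big_ord_recl /tcons/= tnth0; congr (_ * _).
by apply: eq_bigr => i _; rewrite [in LHS](tuple_eta a) !tnthS.
Qed.

Lemma open_cube_cons n (x : T) (t : n.-tuple T) :
  open_cube (tcons (x, t)) <-> (0 < (x : R) < 1) /\ open_cube t.
Proof.
split=> [xt01|[x01 t01] i].
  split; first by have := xt01 ord0; rewrite /tcons/= tnth0.
  by move=> i; have := xt01 (lift ord0 i); rewrite /tcons/= tnthS.
have [j ->|->] := unliftP ord0 i; rewrite /tcons/= ?tnth0// tnthS; exact: t01.
Qed.

Lemma log_moment_ge0 (x : R) s m : 0 <= x -> 0 <= log_moment x s m.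
Proof.
move=> x0; elim: s m => [|e s IH] m /=; first by rewrite ler0n.
by apply: sumr_ge0 => l _; rewrite mulr_ge0// invr_ge0 exprn_ge0// addr_ge0.
Qed.

Lemma measurable_log_pow_tmonom n m (a : n.-tuple nat) D :
  measurable_fun D (fun t : n.-tuple T => (log_pow m (tprod t) * tmonom a t)%:E).
Proof.
apply/measurable_funTS/measurable_EFinP; apply: measurable_funM.
  by apply: measurableT_comp; [exact: measurable_log_pow|exact: measurable_tprod].
exact: measurable_tmonom.
Qed.

Lemma log_pow_tmonom_ge0 n m (a : n.-tuple nat) (t : n.-tuple T) :
  open_cube t -> (0 <= (log_pow m (tprod t) * tmonom a t)%:E)%E.
Proof.
move=> t01; rewrite lee_fin mulr_ge0 ?tmonom_ge0//.
by rewrite log_pow_ge0// tprod_le1.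
Qed.

(** Tonelli and induction on the dimension: the binomial formula splits
    [log_pow m (x * y)] into products, and this matches the recursive
    definition of [log_moment]. *)
Lemma integral_log_pow_tmonom n m (a : n.-tuple nat) :
  (\int[@lebesgue_tuple R n]_(t in @open_cube R n) (log_pow m (tprod t) * tmonom a t)%:E
   = (log_moment 1 a m)%:E)%E.
Proof.
elim: n m a => [|n IH] m a.
  rewrite (_ : @open_cube R 0 = setT); last by apply/seteqP; split=> // t _ [].
  rewrite integral_dirac//; last exact: measurable_log_pow_tmonom.
  rewrite diracT mul1e /tprod/tmonom !big_ord0 mulr1 /log_pow ln1 oppr0 expr0n tuple0/=.
  by case: m => [|m]; rewrite ?mul0r// fact0 divr1.
pose f m n (a : n.-tuple nat) (t : n.-tuple T) := (log_pow m (tprod t) * tmonom a t)%:E.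
have mf k l (b : k.-tuple nat) D : measurable_fun D (f l k b).
  exact: measurable_log_pow_tmonom.
have f0 k l (b : k.-tuple nat) t : open_cube t -> (0 <= f l k b t)%E.
  exact: log_pow_tmonom_ge0.
pose mu := @lebesgue_measure R; pose nu := @lebesgue_tuple R n.
pose D := @tcons _ T n @^-1` @open_cube R n.+1.
have mD : measurable D.
  by rewrite -[D]setTI; apply: measurable_tcons => //; exact: measurable_open_cube.
transitivity (\int[mu \x nu]_(z in D) (f m n.+1 a \o @tcons _ T n) z)%E.
  rewrite -ge0_integral_pushforward//.
  - exact: measurable_tcons.
  - exact: measurable_open_cube.
  - exact: mf.
  - by move=> t; rewrite inE; exact: f0.
rewrite integral_mkcond fubini_tonelli1//=; last 2 first.
- apply/(measurable_restrictT _ _).1 => //.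
  by apply: measurable_funTS; apply: measurableT_comp; [exact: mf|exact: measurable_tcons].
- by move=> z; apply: erestrict_ge0 => w Dw; exact: f0.
pose g l x : R := log_pow l x * x ^+ thead a.
pose a' := [tuple of behead a].
have fub x : fubini_F nu ((f m n.+1 a \o @tcons _ T n) \_ D) x =
   ((fun x => \sum_(l < m.+1) ((g l x)%:E * (log_moment 1 a' (m - l))%:E)%E)%E \_ `]0, 1[) x.
  rewrite /fubini_F patchE; case: ifPn => [|x01].
    rewrite inE/= in_itv/= => x01; have /andP[x0 x1] := x01.
    transitivity (\int[nu]_(t in @open_cube R n)
        \sum_(l < m.+1) ((g l x)%:E * f (m - l)%N n a' t)%E)%E.
      rewrite [RHS]integral_mkcond; apply: eq_integral => t _; rewrite !patchE.
      case: ifPn => [|xt01]; last first.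
        rewrite ifF//; apply/negP; rewrite inE => t01; move/negP: xt01; apply.
        by rewrite inE; apply/open_cube_cons.
      rewrite inE => /open_cube_cons[_ t01]; rewrite ifT ?inE//=.
      rewrite /f tprod_cons tmonom_cons log_powM ?tprod_gt0// mulr_suml -sumEFin.
      by apply: eq_bigr => l _; rewrite -EFinM /g; congr EFin; ring.
    rewrite ge0_integral_sum//.
    - apply: eq_bigr => l _; rewrite ge0_integralZl_EFin ?IH//.
      + exact: measurable_open_cube.
      + by move=> t; exact: f0.
      + exact: mf.
      + by rewrite mulr_ge0 ?exprn_ge0 ?log_pow_ge0// ltW.
    - exact: measurable_open_cube.
    - by move=> l; apply: measurable_funeM; exact: mf.
    - move=> l t t01; rewrite mule_ge0 ?f0// lee_fin.
      by rewrite mulr_ge0 ?exprn_ge0 ?log_pow_ge0// ltW.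
  apply: integral0_eq => t _; rewrite patchE ifF//; apply/negP; rewrite inE.
  by move=> /open_cube_cons[x01' _]; move/negP: x01; apply; rewrite inE/= in_itv.
have mg l D0 : measurable_fun D0 (fun x => (g l x)%:E).
  apply/measurable_funTS/measurable_EFinP.
  by apply: measurable_funM; [exact: measurable_log_pow|exact: measurable_funX].
have g0 l x : 0 < x < 1 -> 0 <= g l x.
  by move=> /andP[/ltW x0 /ltW x1]; rewrite mulr_ge0 ?exprn_ge0 ?log_pow_ge0.
under eq_integral do rewrite fub.
rewrite -integral_mkcond ge0_integral_sum//.
- rewrite [in RHS](tuple_eta a) /= -sumEFin; apply: eq_bigr => l _.
  under eq_integral do rewrite muleC.
  rewrite ge0_integralZl_EFin//.
  + by rewrite integral_log_pow_pow -EFinM mulrC natr1.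
  + by move=> x; rewrite /= in_itv/= lee_fin; exact: g0.
  + exact: mg.
  + by rewrite log_moment_ge0.
- by move=> l; apply: emeasurable_funM; [exact: mg|exact: measurable_cst].
- move=> l x; rewrite /= in_itv/= => x01.
  by rewrite mule_ge0 ?lee_fin ?g0 ?log_moment_ge0.
Qed.
End cube.

(** * The geometric series *)

Section geo.
Local Open Scope classical_set_scope.
Context (R : realType).
Local Notation T := (measurableTypeR R).

Lemma log_moment_shift (F : fieldType) (x : F) k s m :
  log_moment x (map (addn k) s) m = log_moment (k%:R + x) s m.
Proof.
elim: s m => //= e s IH m; apply: eq_bigr => l _.
by rewrite IH natrD [k%:R + _]addrC addrA.
Qed.

Lemma tmonom_shift n (a : n.-tuple nat) k (t : n.-tuple T) :
  tmonom (map_tuple (addn k) a) t = tmonom a t * tprod t ^+ k.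
Proof.
rewrite /tmonom /tprod -prodrXl -big_split/=; apply: eq_bigr => i _.
by rewrite tnth_map exprD mulrC.
Qed.

Lemma tprod_lt1 n (t : n.-tuple T) : (0 < n)%N -> open_cube t -> tprod t < 1.
Proof.
case: n t => // n t _ t01; rewrite /tprod big_ord_recl.
have /andP[t0 t1] := t01 ord0; apply: le_lt_trans t1; apply: ler_piMr; first exact: ltW.
apply: prodr_ile1 => i _; have /andP[/ltW u0 /ltW u1] := t01 (lift ord0 i).
by rewrite u0.
Qed.

Lemma integral_log_pow_geometric n m (a : n.-tuple nat) : (0 < n)%N ->
  (\int[@lebesgue_tuple R n]_(t in @open_cube R n)
     (log_pow m (tprod t) * tmonom a t / (1 - tprod t))%:E
   = \sum_(k <oo) (log_moment (k.+1%:R : R) a m)%:E)%E.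
Proof.
move=> n0.
transitivity (\int[@lebesgue_tuple R n]_(t in @open_cube R n)
  \sum_(k <oo) (log_pow m (tprod t) * tmonom (map_tuple (addn k) a) t)%:E)%E.
  apply: eq_integral => t; rewrite inE => t01; apply/esym/cvg_lim => //.
  under eq_fun do rewrite sumEFin; apply: cvg_EFin; first exact: nearW.
  have := @cvg_geometric_series R (log_pow m (tprod t) * tmonom a t) (tprod t).
  rewrite ger0_norm ?(ltW (tprod_gt0 t01))// => /(_ (tprod_lt1 n0 t01)).
  apply: cvg_trans; apply: near_eq_cvg; apply: nearW => N.
  by rewrite /series/=; apply: eq_bigr => k _; rewrite tmonom_shift mulrA.
rewrite integral_nneseries.
- by apply: eq_eseriesr => k _; rewrite integral_log_pow_tmonom log_moment_shift natr1.
- exact: measurable_open_cube.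
- by move=> k; exact: measurable_log_pow_tmonom.
- by move=> k t; exact: log_pow_tmonom_ge0.
Qed.

(** Up to the factor (-1) ^ m * m! the integrand is the nonnegative function
    whose integral was just computed; finiteness of the sum makes it
    integrable, so that the factor can be moved out. *)
Lemma beukers_integral_eq n m (a : n.-tuple nat) (I : R) : (0 < n)%N ->
  (\sum_(k <oo) (log_moment (k.+1%:R : R) a m)%:E = I%:E)%E ->
  beukers_integral R m a = I%:E.
Proof.
move=> n0 sumI; rewrite /beukers_integral.
pose h (t : n.-tuple T) := (log_pow m (tprod t) * tmonom a t / (1 - tprod t))%:E.
have mh : measurable_fun (@open_cube R n) h.
  apply: (eq_measurable_fun (fun t : n.-tuple T =>
      (log_pow m (tprod t) * tmonom a t * expR (- ln (1 - tprod t)))%:E)).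
    move=> t; rewrite inE => t01; congr EFin; congr (_ * _).
    by rewrite expRN lnK// posrE subr_gt0 tprod_lt1.
  apply/measurable_funTS/measurable_EFinP; apply: measurable_funM.
    apply/measurable_EFinP; exact: measurable_log_pow_tmonom.
  apply: measurableT_comp => //; apply: measurableT_comp => //.
  apply: measurableT_comp; first exact: measurable_ln.
  by apply: measurable_funB => //; exact: measurable_tprod.
have intI := integral_log_pow_geometric m a n0; rewrite sumI in intI.
have inth : (@lebesgue_tuple R n).-integrable (@open_cube R n) h.
  apply/integrableP; split => //.
  under eq_integral => t.
    rewrite inE => t01; rewrite gee0_abs; last first.
      rewrite lee_fin divr_ge0 ?subr_ge0 ?tprod_le1//.
      by rewrite -lee_fin log_pow_tmonom_ge0.
    over.
  by rewrite intI ltry.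
pose c : R := (-1) ^+ m * m`!%:R.
transitivity (((-1) ^+ m / m`!%:R)%:E *
  \int[@lebesgue_tuple R n]_(t in @open_cube R n) (c%:E * h t))%E.
  congr (_ * _)%E; apply: eq_integral => t _; rewrite /h -EFinM; congr EFin.
  rewrite /c /log_pow [(- ln _) ^+ m]exprNn -/(tprod t) -/(tmonom a t).
  set r := (1 - _)^-1; set e := (-1) ^+ m.
  transitivity (e * e * (ln (tprod t) ^+ m * tmonom a t * r)).
    by rewrite -expr2 sqrr_sign mul1r.
  by field; rewrite pnatr_eq0 -lt0n fact_gt0.
rewrite integralZl//; last exact: measurable_open_cube.
rewrite intI -!EFinM; congr EFin; rewrite /c.
set e := (-1) ^+ m; transitivity (e * e * I).
  by field; rewrite pnatr_eq0 -lt0n fact_gt0.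
by rewrite -expr2 sqrr_sign mul1r.
Qed.
End geo.

(** * Summation in terms of zeta values *)

Section zeta_limit.
Local Open Scope classical_set_scope.
Context (R : realType).

Lemma HsumS s N : Hsum s N.+1 = Hsum s N + N.+1%:R ^- s.
Proof. by rewrite /Hsum big_nat_recr. Qed.

Lemma ratr_HsumS s N :
  ratr (Hsum s N.+1) = ratr (Hsum s N) + N.+1%:R ^- s :> R.
Proof. by rewrite HsumS rmorphD/= fmorphV rmorphXn/= ratr_nat. Qed.

Lemma sum_shifted_powers s v K :
  \sum_(k < K) (v%:R + k.+1%:R) ^- s = Hsum s (v + K) - Hsum s v :> rat.
Proof.
elim: K => [|K IH]; first by rewrite big_ord0 addn0 subrr.
by rewrite big_ord_recr/= IH addnS HsumS -natrD addnS; ring.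
Qed.

Lemma cvg_inv_pow_shift s v : (0 < s)%N ->
  ((v + K).+1%:R ^- s : R) @[K --> \oo] --> (0 : R).
Proof.
move=> s0; apply: (@squeeze_cvgr _ _ _ _ (cst 0) (@harmonic R)).
- apply: nearW => K; rewrite invr_ge0 exprn_ge0//= lef_pV2 ?posrE ?exprn_gt0//.
  rewrite (@le_trans _ _ (v + K).+1%:R)//.
    by rewrite ler_nat ltnS leq_addl.
  by rewrite ler_eXnr// ler1n.
- exact: cvg_cst.
- exact: cvg_harmonic.
Qed.

Lemma cvg_Hsum_shift s v : (0 < s)%N ->
  (ratr (Hsum s (v + K)) - ratr (Hsum s K) : R) @[K --> \oo] --> (0 : R).
Proof.
move=> s0; elim: v => [|v IH].
  by under eq_fun do rewrite add0n subrr; exact: cvg_cst.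
under eq_fun do rewrite addSn ratr_HsumS addrAC.
rewrite -[X in nbhs X](addr0 (0 : R)); apply: cvgD; [exact: IH|exact: cvg_inv_pow_shift].
Qed.

Lemma series_riemannE s K :
  series (riemannR (s%:R : R)) K = ratr (Hsum s K).
Proof.
elim: K => [|K IH]; first by rewrite /series/= /Hsum !big_geq// rmorph0.
by rewrite ratr_HsumS -IH /series/= big_nat_recr//= /riemannR powR_mulrn.
Qed.

(** Telescoping: 1 / (K + 2) ^ 2 <= 1 / (K + 1) - 1 / (K + 2). *)
Lemma Hsum_le2 s K : (2 <= s)%N -> (ratr (Hsum s K.+1) <= 2 - K.+1%:R^-1 :> R).
Proof.
move=> s2; elim: K => [|K IH].
  by rewrite ratr_HsumS {1}/Hsum big_geq// rmorph0 expr1n invr1; lra.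
rewrite ratr_HsumS.
have h : K.+2%:R ^- s <= K.+1%:R^-1 - K.+2%:R^-1 :> R.
  rewrite (@le_trans _ _ (K.+2%:R ^- 2))//.
    by rewrite lef_pV2 ?posrE ?exprn_gt0// ler_weXn2l// ler1n.
  have -> : K.+1%:R^-1 - K.+2%:R^-1 = (K.+1%:R * K.+2%:R)^-1 :> R.
    rewrite -[K.+2]add1n natrD; field.
    by rewrite !nat1r !pnatr_eq0.
  by rewrite lef_pV2 ?posrE ?exprn_gt0 ?mulr_gt0// expr2 ler_pM2r// ler_nat.
by rewrite (le_trans (lerD IH h))// addrA subrK.
Qed.

Lemma cvg_Hsum_zeta s : (2 <= s)%N ->
  (ratr (Hsum s K) : R) @[K --> \oo] --> zeta (s%:R : R).
Proof.
move=> s2; rewrite /zeta.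
have -> : (fun K => ratr (Hsum s K) : R) = series (riemannR (s%:R : R)).
  by apply/funext => K; rewrite series_riemannE.
apply: nondecreasing_is_cvgn.
  apply/nondecreasing_seqP => K; rewrite !series_riemannE ratr_HsumS.
  by rewrite lerDl invr_ge0 exprn_ge0.
exists 2 => _ [K _ <-]; rewrite series_riemannE.
apply: (@le_trans _ _ (ratr (Hsum s K.+1))).
  by rewrite ratr_HsumS lerDl invr_ge0 exprn_ge0.
by apply: le_trans (Hsum_le2 K s2) _; rewrite gerBl invr_ge0.
Qed.

(** The sum over k >= 0 of the m-th derived decomposition at k + 1.  The
    divergent (for m = 0) harmonic series of the simple poles, j = 0, is left
    out, since its total coefficient is 0. *)
Definition pf_limit (V : seq nat) (N : nat) (lam : nat -> nat -> rat) m : R :=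
  \sum_(v <- V) \sum_(j < N) ratr (lam v j * 'C(m + j, m)%:R) *
    ((if j == 0%N :> nat then 0 else zeta ((m + j).+1%:R : R))
     - ratr (Hsum (m + j).+1 v)).

(** The partial sums of the terms at v are H_s(v + K) - H_s(v).  For the simple
    poles one may subtract H_(m+1)(K) from each H_(m+1)(v + K) because the
    residues add up to 0, and the differences tend to 0. *)
Lemma cvg_pf_sum V N lam m : \sum_(v <- V) lam v 0%N = 0 ->
  (\sum_(k < K) ratr (pf_sum V N lam m k.+1%:R) : R) @[K --> \oo]
    --> pf_limit V N lam m.
Proof.
move=> lam0.
pose c v j : R := ratr (lam v j * 'C(m + j, m)%:R).
pose h s K : R := ratr (Hsum s K).
pose u K v j := c v j *
  ((h (m + j).+1 (v + K)%N - (if j == 0%N then h (m + j).+1 K else 0)) - h (m + j).+1 v).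
have E K : \sum_(k < K) ratr (pf_sum V N lam m k.+1%:R) =
    \sum_(v <- V) \sum_(j < N) u K v j.
  have sum0 : \sum_(v <- V) c v 0%N * h m.+1 K = 0.
    rewrite -mulr_suml /c; under eq_bigr do rewrite rmorphM/=.
    by rewrite -mulr_suml -rmorph_sum/= lam0 rmorph0 !mul0r.
  rewrite -rmorph_sum/= /pf_sum exchange_big/=.
  under eq_bigr do rewrite exchange_big/=.
  transitivity (\sum_(v <- V) \sum_(j < N) c v j * (h (m + j).+1 (v + K)%N - h (m + j).+1 v)).
    rewrite rmorph_sum; apply: eq_bigr => v _; rewrite rmorph_sum; apply: eq_bigr => j _.
    rewrite /diff_pole; under eq_bigr do rewrite mulrA.
    by rewrite -mulr_sumr sum_shifted_powers rmorphM rmorphB.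
  case: N => [|N']; first by apply: eq_bigr => v _; rewrite !big_ord0.
  rewrite -[LHS]subr0 -[X in _ - X = _]sum0 -sumrB; apply: eq_bigr => v _.
  rewrite !big_ord_recl/= addrAC /u/=; congr (_ + _).
    by rewrite addn0; ring.
  by apply: eq_bigr => j _; rewrite subr0.
under eq_fun do rewrite E.
rewrite /pf_limit; apply: cvg_big => [|v _]; first exact: add_continuous.
apply: cvg_big => [|j _]; first exact: add_continuous.
apply: cvgMl_tmp; apply: cvgB; last exact: cvg_cst.
case: eqP => [j0|/eqP j0]; first exact: cvg_Hsum_shift.
have -> : (fun K => h (m + j).+1 (v + K)%N - 0) =
    (fun K => (h (m + j).+1 (v + K)%N - h (m + j).+1 K) + h (m + j).+1 K).
  by apply/funext => K; ring.
rewrite -[X in _ --> X]add0r; apply: cvgD; first exact: cvg_Hsum_shift.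
by apply: cvg_Hsum_zeta; rewrite ltnS addn_gt0 (lt0n j) j0 orbT.
Qed.
End zeta_limit.

(** * The evaluation and the denominator *)

Lemma log_moment_ratr (R : realType) (k : nat) s m :
  log_moment (k%:R : R) s m = ratr (log_moment (k%:R : rat) s m).
Proof.
elim: s m => [|e s IH] m /=; first by rewrite ratr_nat.
rewrite rmorph_sum; apply: eq_bigr => l _.
by rewrite IH rmorphM/= fmorphV rmorphXn rmorphD/= !ratr_nat.
Qed.

(** Exchanging the sums over values and over orders; the coefficients of the
    orders above b_max vanish. *)
Lemma pf_limitE (R : realType) a lam m :
  (forall v j, (count_mem v a <= j)%N -> lam v j = 0) -> (0 < mmul_max a)%N ->
  pf_limit R (values a) (size a) lam m =
  ratr (harmonic_coef m (values a) (size a) lam) +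
  \sum_(2 <= j < (mmul_max a).+1)
     ratr (zeta_coef m (values a) lam j.-1) * zeta ((m + j)%:R : R).
Proof.
move=> lam0 b0.
pose Z j : R := if j == 0%N then 0 else zeta ((m + j).+1%:R : R).
have -> : \sum_(2 <= j < (mmul_max a).+1)
     ratr (zeta_coef m (values a) lam j.-1) * zeta ((m + j)%:R : R) =
    \sum_(j < size a) ratr (zeta_coef m (values a) lam j) * Z j.
  transitivity (\sum_(0 <= j < mmul_max a) ratr (zeta_coef m (values a) lam j) * Z j).
    rewrite big_add1/= [RHS]big_ltn// /Z/= mulr0 add0r.
    by apply: eq_big_nat => -[|j] // _; rewrite /= addnS.
  rewrite (big_nat_widen _ _ _ _ _ (mmul_max_le a)) big_mkord big_mkcond/=.
  apply: eq_bigr => j _; case: ltnP => // bj; rewrite /zeta_coef big_seq big1 ?rmorph0 ?mul0r//.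
  move=> v; rewrite mem_values => va; rewrite lam0 ?mul0r//.
  exact: leq_trans (count_le_max va) bj.
rewrite /harmonic_coef rmorphN/= rmorph_sum/=.
under [X in _ = _ + X]eq_bigr do rewrite /zeta_coef rmorph_sum/= mulr_suml.
rewrite exchange_big/= -sumrN -big_split/= /pf_limit; apply: eq_bigr => v _.
rewrite rmorph_sum/= -sumrN -big_split/=; apply: eq_bigr => j _.
by rewrite mulrBr addrC -rmorphM -/(Z j).
Qed.

Theorem theorem5 (R : realType) (n m : nat) (a : n.-tuple nat) (hn : (2 <= n)%N) :
  (exists mu : nat -> nat -> rat, partial_fractions a mu) /\
  forall mu : nat -> nat -> rat, partial_fractions a mu ->
    let r := mcard a in
    let c := mval a in
    let b_max := mmul_max a in
    (exists (p : nat -> int) (q : int),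
       reduced_fractions b_max (beukers_coef m a mu) p q) /\
    forall (p : nat -> int) (q : int),
      reduced_fractions b_max (beukers_coef m a mu) p q ->
      [/\ beukers_integral R m a =
            ((((p 1%N)%:~R +
               \sum_(2 <= j < b_max.+1) (p j)%:~R * zeta ((m + j)%:R : R))
              / q%:~R)%:E)%E,
          r = 1%N ->
            (q %| (lcm_upto (nth 0%N a n.-1) ^ (n + m))%N%:Z)%Z &
          (1 < r)%N ->
            (q %| ((b_max - 1)`! * lcm_upto (c r) ^ (m + b_max) *
                   \prod_(1 <= s < r.+1) \prod_(s.+1 <= t < r.+1)
                      (c t - c s) ^ (n - 1))%N%:Z)%Z].
Proof.
have sz : size a = n := size_tuple a.
have a2 : (2 <= size a)%N by rewrite sz.
have [||||lam [lam0 lam_int lam_sum lamE]] :=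
    @partial_fraction_expansion (values a) (value_gaps a)%:R a (values_uniq a).
- exact: rpred_nat.
- exact: value_gaps_div.
- by move=> v; rewrite mem_values.
- by rewrite -size_eq0 -lt0n ltnW.
have {}lam_sum := lam_sum a2.
split.
  exists (fun i j => lam (mval a i) j.-1) => x x0.
  rewrite -log_moment0 lamE; last first.
    move=> v va; have va' : v \in (a : seq nat) by rewrite -mem_values.
    by rewrite -(mval_index va'); apply: x0; exact: index_values.
  rewrite pf_sum_mval; apply: eq_big_seq => v va; apply: eq_bigr => j _.
  have va' : v \in (a : seq nat) by rewrite -mem_values.
  rewrite /coefs_by_value; case: ltnP => [_|/lam0 ->//].
  by rewrite (mval_index va').
move=> mu pf r c b_max.
have b1 : (1 <= b_max)%N.
  have [v va] : exists v, v \in (a : seq nat).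
    by case: (tval a) a2 => // v s _; exists v; rewrite mem_head.
  by apply: leq_trans (count_le_max va); rewrite -has_count has_pred1.
have coef1 := beukers_coef1 m lam0 lam_sum lamE a2 pf.
have coefS j : (2 <= j <= b_max)%N ->
    beukers_coef m a mu j = zeta_coef m (values a) lam j.-1.
  case: j => [|j] // /andP[j2 jb]; apply: (beukers_coefS m lam0 lamE a2 pf).
  by apply/andP; split; [exact: j2|exact: leq_trans jb (mmul_max_le _)].
have coef_int j : (1 <= j <= b_max)%N ->
    (denominator_bound m a)%:R * beukers_coef m a mu j \is a Num.int.
  case: j => [|[|j]] // jb; first by rewrite coef1; exact: harmonic_coef_int.
  rewrite coefS//; apply: zeta_coef_int => //.
  exact: leq_trans (proj2 (andP jb)) (mmul_max_le _).
split; first exact: reduced_fractions_exists (denominator_bound_gt0 m a) coef_int.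
move=> p q red; have q_dvd := reduced_fractions_dvd red coef_int.
have [q0 coefE _] := red.
have ratr_coef j : (1 <= j <= b_max)%N ->
    ratr (beukers_coef m a mu j) = (p j)%:~R / q%:~R :> R.
  by move=> jb; rewrite coefE// fmorph_div/= !ratr_int.
split.
- apply: beukers_integral_eq; first exact: ltnW.
  have -> : ((p 1%N)%:~R +
      \sum_(2 <= j < b_max.+1) (p j)%:~R * zeta ((m + j)%:R : R)) / q%:~R = pf_limit R (values a) (size a) lam m.
    rewrite pf_limitE// -coef1 ratr_coef ?b1// mulrDl; congr (_ + _).
    rewrite mulr_suml; apply: eq_big_nat => j /andP[j2 jb].
    by rewrite -coefS ?j2// ratr_coef ?(ltnW j2)// mulrAC.
  apply/cvg_lim => //; under eq_fun do rewrite sumEFin.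
  apply: cvg_EFin; first exact: nearW.
  have := @cvg_pf_sum R (values a) (size a) lam m lam_sum.
  apply: cvg_trans; apply: near_eq_cvg; apply: nearW => K.
  rewrite /= big_mkord; apply: eq_bigr => k _; rewrite log_moment_ratr lamE//.
- move=> r1; have c1 : nth 0%N a n.-1 = mval a 1.
    have va : nth 0%N a n.-1 \in (a : seq nat) by rewrite mem_nth// sz; lia.
    rewrite -(mval_index va); congr (mval a _).
    by have := index_values va; rewrite -/r r1 => /andP[_]; rewrite ltnS leqn0 => /eqP ->.
  have b_n : mmul_max a = n.
    by rewrite /mmul_max -/r r1 big_nat1 mmul_single.
  move: q_dvd; rewrite /denominator_bound -/r r1 b_n -c1 /value_gaps -/r r1.
  by rewrite big_nat1 big_geq// exp1n muln1 addnC.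
- move=> _; rewrite value_gaps_exp -mulnA PoszM dvdz_mull//.
  by move: q_dvd; rewrite /denominator_bound sz.
Qed.
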